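(* Let $p$ be a prime, let $S$ be a finitely generated (abstract) free group and let $n\geq1$. Then: (a) $S_{(n)}$ is the intersection of the kernels of all group homomorphisms $\rho\colon S\to\mathrm{U}_n(\mathbb{F}_p)$; (b) $S_n$ is the intersection of the kernels of all group homomorphisms $\rho\colon S\to\mathrm{U}_n(\mathbb{Z})$; (c) $S^{(n)}$ is the intersection of the kernels of all group homomorphisms $\rho\colon S\to\mathrm{U}_{k+1}(\mathbb{Z}/p^{n-k}\mathbb{Z})$, where $k$ ranges over $1,\ldots,n-1$.
   Context: For a commutative unital ring $\Lambda$, $\mathrm{U}_m(\Lambda)$ is the group of upper-triangular unipotent $m\times m$ matrices over $\Lambda$. For an abstract group $G$: $G_1=G$, $G_{i+1}=[G_i,G]$ (descending central series); $G^{(1)}=G$, $G^{(i+1)}=(G^{(i)})^p[G^{(i)},G]$ (descending $p$-central series); $G_{(1)}=G$, $G_{(n)}=G_{(\lceil n/p\rceil)}^p\prod_{i+j=n}[G_{(i)},G_{(j)}]$ ($p$-Zassenhaus filtration), where $[H,K]$ is the subgroup generated by commutators $x^{-1}y^{-1}xy$ with $x\in H$, $y\in K$, and $H^p$ the subgroup generated by $p$-th powers of elements of $H$. *)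

(* Defs.v *)
From HB Require Import structures.
From mathcomp Require Import all_boot all_order all_algebra.
Set Implicit Arguments. Unset Strict Implicit. Unset Printing Implicit Defensive.
Import GRing.Theory.

Section FreeGroup.
Variable d : nat.

Definition letter := ('I_d * bool)%type.
Definition flip (x : letter) : letter := (x.1, ~~ x.2).

Definition reducedb (w : seq letter) : bool := sorted (fun a b => b != flip a) w.

Definition red_step (x : letter) (acc : seq letter) : seq letter :=
  if acc is y :: t then (if y == flip x then t else x :: acc) else [:: x].

Definition reduce (w : seq letter) : seq letter := foldr red_step [::] w.

Lemma reduce_reduced w : reducedb (reduce w).
Proof.
elim: w => //= x w; rewrite /red_step; case: (reduce w) => [|y t] //= IH.
case: eqP => [_|/eqP ne]; first exact: (path_sorted IH).
by rewrite /= ne IH.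
Qed.

Definition FG := {w : seq letter | reducedb w}.

Definition fg_one : FG := exist _ [::] isT.
Definition fg_mul (x y : FG) : FG :=
  exist _ (reduce (proj1_sig x ++ proj1_sig y)) (reduce_reduced _).
Definition fg_inv (x : FG) : FG :=
  exist _ (reduce (rev (map flip (proj1_sig x)))) (reduce_reduced _).
Definition fg_gen (i : 'I_d) : FG := exist _ [:: (i, true)] isT.

Definition fg_exp (x : FG) (k : nat) : FG := iter k (fg_mul x) fg_one.
Definition fg_comm (x y : FG) : FG :=
  fg_mul (fg_mul (fg_inv x) (fg_inv y)) (fg_mul x y).

Inductive gen (A : FG -> Prop) : FG -> Prop :=
| gen_in x : A x -> gen A x
| gen_one : gen A fg_one
| gen_mul x y : gen A x -> gen A y -> gen A (fg_mul x y)
| gen_inv x : gen A x -> gen A (fg_inv x).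

Definition fullgrp : FG -> Prop := fun _ => True.

Definition commg_sub (H K : FG -> Prop) : FG -> Prop :=
  gen (fun z => exists x y, H x /\ K y /\ z = fg_comm x y).

Definition powg_sub (p : nat) (H : FG -> Prop) : FG -> Prop :=
  gen (fun z => exists x, H x /\ z = fg_exp x p).

Fixpoint lcs (n : nat) : FG -> Prop :=
  match n with
  | 0 | 1 => fullgrp
  | m.+1 => commg_sub (lcs m) fullgrp
  end.

Fixpoint pcs (p n : nat) : FG -> Prop :=
  match n with
  | 0 | 1 => fullgrp
  | m.+1 => gen (fun z => powg_sub p (pcs p m) z \/ commg_sub (pcs p m) fullgrp z)
  end.

(* p-Zassenhaus filtration: G_(1) = G,
   G_(n) = G_(ceil(n/p))^p * prod_{i+j=n, i,j>=1} [G_(i), G_(j)];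
   defined with fuel k (only used with k = n). *)
Fixpoint zass_aux (p k n : nat) : FG -> Prop :=
  match k with
  | 0 => fullgrp
  | k'.+1 =>
    if n <= 1 then fullgrp else
    gen (fun z => powg_sub p (zass_aux p k' ((n + p.-1) %/ p)) z \/
                  exists i j, [/\ 0 < i, 0 < j, i + j = n &
                    commg_sub (zass_aux p k' i) (zass_aux p k' j) z])
  end.

Definition zass (p n : nat) : FG -> Prop := zass_aux p n n.

End FreeGroup.

Definition unitriangular (R : pzRingType) (m : nat) (A : 'M[R]_m) : Prop :=
  (forall i j : 'I_m, (j < i)%N -> A i j = 0%R) /\ (forall i : 'I_m, A i i = 1%R).

Definition hom_to_U (d : nat) (R : pzRingType) (m : nat) (rho : FG d -> 'M[R]_m) : Prop :=
  (forall x, unitriangular (rho x)) /\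
  (forall x y, rho (fg_mul x y) = (rho x *m rho y)%R).

(* Main.v *)
Require Import Defs.
From HB Require Import structures.
From mathcomp Require Import all_boot all_order all_algebra.
From mathcomp Require Import zify ring lra.

(** Write [eps x w] for the coefficient of the word [w] in the Magnus expansion
    of [x], which sends the generator number [i] to [1 + X_i].  The matrix of
    the coefficients of all factors of a fixed word is a unitriangular
    representation, and conversely each filtration is mapped by every
    unitriangular representation into the matching filtration of the matrix
    ring.  So the claim is that [x] lies in the n-th term as soon as [eps x w]
    is 0, resp. divisible by [p], resp. by [p ^ (n - |w|)], for all nonempty
    words [w] of length [< n].

    Lazard elimination writes every [x], modulo [lcs n], as a product of powers
    of iterated commutators [c].  Eliminating a generator [z], with attached
    word [v], replaces any other generator [y], with attached word [u], by the
    commutators [[y, z, ..., z]] with attached words [u v ... v].  When the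
    generator eliminated is always the one whose word has the largest periodic
    extension [v v v ...], the attached word [l] of [c] is the least word of
    length [|l|] in the expansion of [c], with coefficient 1, and distinct
    factors have words with distinct periodic extensions.
    Hence the least obstructions of the factors (at [l], or at [l] to the power
    [p ^ e] in the Zassenhaus case) cannot cancel in the product, and every
    factor lies in the required term of the filtration. *)

Set Implicit Arguments. Unset Strict Implicit. Unset Printing Implicit Defensive.
Import Order.TTheory GRing.Theory Num.Theory.

(** * The free group as a group *)

Section FreeGroupLaws.
Variable d : nat.
Implicit Types (x : letter d) (s t : seq (letter d)).

Lemma flipK x : flip (flip x) = x.
Proof. by case: x => i b; rewrite /flip /= negbK. Qed.

Lemma red_step_reduced x s : reducedb s -> reducedb (red_step x s).
Proof.
case: s => [|y s] //= ys; case: eqP => [_|/eqP ne]; first exact: path_sorted ys.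
by rewrite /= ne.
Qed.

Lemma red_stepK x s : reducedb s -> red_step x (red_step (flip x) s) = s.
Proof.
case: s => [|y s] /=; first by rewrite eqxx.
rewrite flipK; case: eqP => [->|_] /=; last by rewrite eqxx.
by case: s => [|z s] //= /andP[/negPf->].
Qed.

Lemma reduce_id s : reducedb s -> reduce s = s.
Proof.
elim: s => //= x s IH xs; rewrite IH; last exact: path_sorted xs.
by case: s xs {IH} => [|y s] //= /andP[/negPf->].
Qed.

Definition redcat s t := foldr (@red_step d) t s.

Lemma reduce_cat s t : reduce (s ++ t) = redcat s (reduce t).
Proof. by rewrite /reduce foldr_cat. Qed.

Lemma redcat_reduced s t : reducedb t -> reducedb (redcat s t).
Proof. by move=> tr; elim: s => //= x s; apply: red_step_reduced. Qed.

(** [redcat] lets words act on reduced words, and by [red_stepK] each letter acts bijectively with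
    its flip as inverse. Cancelling inverse neighbours thus keeps the action, whence
    associativity. *)
Lemma redcat_reduce s t : reducedb t -> redcat (reduce s) t = redcat s t.
Proof.
move=> tr; elim: s => //= x s <-; case E: (reduce s) => [|y u] //=.
case: eqP => [->|_] //=; rewrite red_stepK //; exact: redcat_reduced.
Qed.

Lemma reduce_catl s t : reduce (reduce s ++ t) = reduce (s ++ t).
Proof. by rewrite !reduce_cat redcat_reduce ?reduce_reduced. Qed.

Lemma reduce_catr s t : reduce (s ++ reduce t) = reduce (s ++ t).
Proof. by rewrite !reduce_cat (reduce_id (reduce_reduced t)). Qed.

Lemma reduce_catV s : reduce (rev (map (@flip d) s) ++ s) = [::].
Proof.
elim: s => //= x s IH.
rewrite rev_cons cat_rcons reduce_cat /=.
by rewrite -{2}(flipK x) red_stepK ?reduce_reduced // -reduce_cat.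
Qed.

Lemma fg_mulA : associative (@fg_mul d).
Proof. by move=> x y z; apply/val_inj; rewrite /= reduce_catr reduce_catl catA. Qed.

Lemma fg_mul1 : left_id (@fg_one d) (@fg_mul d).
Proof. by move=> x; apply/val_inj; rewrite /= reduce_id ?(valP x). Qed.

Lemma fg_mulr1 : right_id (@fg_one d) (@fg_mul d).
Proof. by move=> x; apply/val_inj; rewrite /= cats0 reduce_id ?(valP x). Qed.

Lemma fg_mulV : left_inverse (@fg_one d) (@fg_inv d) (@fg_mul d).
Proof. by move=> x; apply/val_inj; rewrite /= reduce_catl reduce_catV. Qed.

Lemma fg_mulrV : right_inverse (@fg_one d) (@fg_inv d) (@fg_mul d).
Proof.
move=> x; rewrite -[LHS]fg_mul1 -{1}(fg_mulV (fg_inv x)) -fg_mulA.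
by rewrite [fg_mul (fg_inv x) _]fg_mulA fg_mulV fg_mul1 fg_mulV.
Qed.

End FreeGroupLaws.

HB.instance Definition _ d := Choice.copy (FG d) {w : seq (letter d) | reducedb w}.
HB.instance Definition _ d :=
  isGroup.Build (FG d) (@fg_mulA d) (@fg_mul1 d) (@fg_mulr1 d) (@fg_mulV d) (@fg_mulrV d).

(** * Lower central series *)

Lemma hall_witt (G : groupType) (x y z : G) :
  ([~ [~ x, y^-1], z] ^ y * [~ [~ y, z^-1], x] ^ z * [~ [~ z, x^-1], y] ^ x = 1)%g.
Proof.
rewrite /commg /conjg !(invgM, invgK) !mulgA.
by do ?[rewrite mulgK | rewrite mulgVK]; rewrite mulVg.
Qed.

Lemma commgMr (G : groupType) (x y z : G) : ([~ x, y * z] = [~ x, z] * [~ x, y] ^ z)%g.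
Proof. by rewrite /commg /conjg !(invgM, invgK) !mulgA; do ?[rewrite mulgK | rewrite mulgVK]. Qed.

Lemma commgVr (G : groupType) (x y : G) : ([~ x, y^-1] = ([~ x, y] ^ y^-1)^-1)%g.
Proof. by rewrite /commg /conjg !(invgM, invgK) !mulgA mulgV mul1g. Qed.

Section LowerCentralSeries.
Variable d : nat.
Local Open Scope group_scope.
Implicit Types (x y z : FG d) (A B H K N : FG d -> Prop).

Lemma fg_commE x y : fg_comm x y = [~ x, y].
Proof. by rewrite /commg /conjg mulgA. Qed.

Lemma fg_expE x k : fg_exp x k = x ^+ k.
Proof. by elim: k => //= k IH; rewrite expgS -IH. Qed.

Definition subgrp H := [/\ H 1, forall x y, H x -> H y -> H (x * y)
                        & forall x, H x -> H x^-1].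

Definition normalized H := forall x y, H x -> H (x ^ y).

Lemma subgrpX H x k : subgrp H -> H x -> H (x ^+ k).
Proof. by case=> h1 hM _ Hx; elim: k => // k IH; rewrite expgS; apply: hM. Qed.

Lemma subgrp_prod H (s : seq (FG d)) : subgrp H -> {in s, forall x, H x} ->
  H (\prod_(x <- s) x).
Proof.
case=> h1 hM _; elim: s => [|x s IH] Hs; first by rewrite big_nil.
rewrite big_cons; apply: hM; first by apply: Hs; rewrite mem_head.
by apply: IH => y ys; apply: Hs; rewrite inE ys orbT.
Qed.

Lemma gen_subgrp A : subgrp (gen A).
Proof. by split; [exact: gen_one | exact: gen_mul | exact: gen_inv]. Qed.

Lemma gen_min A H : subgrp H -> (forall x, A x -> H x) -> forall x, gen A x -> H x.
Proof. by case=> h1 hM hV AH x; elim=> [y /AH||y z _ Hy _|y _] //; [apply: hM | apply: hV]. Qed.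

Lemma genS A B : (forall x, A x -> B x) -> forall x, gen A x -> gen B x.
Proof. by move=> AB; apply: gen_min (gen_subgrp B) _ => x /AB; apply: gen_in. Qed.

Lemma gen_cycleP x y : gen (eq x) y -> exists k, y = x ^+ k \/ y = x ^- k.
Proof.
elim=> [_ <-||y1 y2 _ [k Hk] _ [l Hl]|y1 _ [k [->|->]]].
- by exists 1%N; left; rewrite expg1.
- by exists 0%N; left.
- have mix i j : exists m, x ^+ i * x ^- j = x ^+ m \/ x ^+ i * x ^- j = x ^- m.
    case: (leqP j i) => ij; first by exists (i - j)%N; left; rewrite expgnFr.
    exists (j - i)%N; right; rewrite expgnFr 1?ltnW // invgM invgK //.
  case: Hk Hl => -> [] ->.
  + by exists (k + l)%N; left; rewrite expgnDr.
  + exact: mix.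
  + have [m Hm] := mix l k; exists m.
    suff -> : fg_mul (x ^- k) (x ^+ l) = x ^+ l * x ^- k by [].
    exact/commute_sym/commuteV/commuteX2.
  + by exists (l + k)%N; right; rewrite expgnDr invgM //.
- by exists k; right.
- by exists k; left; apply: invgK.
Qed.

Lemma commg_sub_normalized H K : normalized H -> normalized K -> normalized (commg_sub H K).
Proof.
move=> nH nK z f; elim=> [_ [x [y [Hx [Ky ->]]]]||x y _ Hx _ Hy|x _ Hx].
- rewrite fg_commE conjRg -fg_commE; apply: gen_in.
  by exists (x ^ f), (y ^ f); split; [apply: nH | split; [apply: nK|]].
- by rewrite [_ ^ f]conj1g; apply: gen_one.
- by rewrite [_ ^ f]conjMg; apply: gen_mul.
- by rewrite [_ ^ f]conjVg; apply: gen_inv.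
Qed.

Lemma lcsSE m : (0 < m)%N -> lcs (d := d) m.+1 = commg_sub (lcs (d := d) m) (@fullgrp d).
Proof. by case: m. Qed.

Lemma lcs_subgrp m : subgrp (@lcs d m).
Proof. by case: m => [|[|m]] //; apply: gen_subgrp. Qed.

Lemma lcs_normalized m : normalized (@lcs d m).
Proof. by elim: m => [|[|m] IH] //; apply: commg_sub_normalized. Qed.

Lemma lcs_succ m x : lcs m.+1 x -> lcs m x.
Proof.
case: m => [|m] //; rewrite lcsSE //; apply: (gen_min (lcs_subgrp _)) => _ [y [f [Hy [_ ->]]]].
have [_ hM hV] := lcs_subgrp m.+1; rewrite fg_commE.
by apply: hM; [apply: hV | apply: lcs_normalized].
Qed.

Lemma lcs_le m k x : (m <= k)%N -> lcs k x -> lcs m x.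
Proof. by move/subnK <-; elim: (k - m)%N => // j IH /lcs_succ. Qed.

(** Three subgroup argument: for a generator [[y, f]] of [lcs b.+2], Hall-Witt expresses [[[y, f],
    x]] through [[[x, y^-1], f^-1]] and [[[f^-1, x^-1], y]], both covered by the induction on [b]
    with [a] arbitrary. *)
Lemma lcs_comm a b x y : (0 < a)%N -> (0 < b)%N -> lcs a x -> lcs b y -> lcs (a + b)%N [~ x, y].
Proof.
case: b => // b a0 _; elim: b a a0 x y => [|b IH] a a0 x y Hx.
  move=> _; rewrite addn1 lcsSE // -fg_commE; apply: gen_in; exists x, y; by split.
have [n1 nM nV] := lcs_subgrp (a + b.+2)%N; have nN := @lcs_normalized (a + b.+2)%N.
rewrite lcsSE // => Hy; move: y Hy x Hx; apply: gen_min.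
  split=> [x _|y z Hy Hz x Hx|y Hy x Hx]; first by rewrite commg1.
    by rewrite commgMr; apply: nM; [apply: Hz | apply/nN/Hy].
  by rewrite commgVr; apply/nV/nN/Hy.
move=> _ [y [f [Hy [_ ->]]]] x Hx; rewrite fg_commE -invgR; apply: (nV).
have V1 m z : lcs m z -> lcs m z^-1 by case: (lcs_subgrp m) => _ _; apply.
have := hall_witt x y f^-1; rewrite invgK.
set u := [~ _, x]; set v := _ ^ y; set w := _ ^ x => E.
have Hv : lcs (a + b.+2)%N v.
  apply: nN; rewrite addnS lcsSE ?addnS // -fg_commE -addnS; apply: gen_in.
  exists [~ x, y^-1], f^-1; split=> //; by apply: IH => //; apply: V1.
have Hw : lcs (a + b.+2)%N w.
  apply: nN; rewrite -addSnnS; apply: IH => //; rewrite -invgR; apply: (V1).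
  rewrite lcsSE // -fg_commE; apply: gen_in; exists x^-1, f^-1.
  by split; first exact: V1.
suff -> : u = (v^-1 * w^-1) ^ f by apply: nN; apply: nM; apply: (nV).
have -> : v^-1 * w^-1 = u ^ f^-1; last by rewrite -conjgM mulVg conjg1.
move/(congr1 (fun t => v^-1 * t * w^-1)): E.
by rewrite -[v * _ * w]mulgA mulKg mulgK mulg1.
Qed.

End LowerCentralSeries.

(** * Filtered rings and unitriangular matrices *)

Section FilteredRing.
Local Open Scope ring_scope.
Variables (T : pzRingType) (J : nat -> T -> Prop).
Hypotheses (J0 : forall m, J m 0)
  (JD : forall m a b, J m a -> J m b -> J m (a + b))
  (JN : forall m a, J m a -> J m (- a))
  (JM : forall m l a b, J m a -> J l b -> J (m + l) (a * b))
  (Jle : forall m k a, (m <= k)%N -> J k a -> J m a).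

Lemma mul_sub1 (a b : T) : (a - 1) * (b - 1) = a * b - (a + (b - 1)).
Proof. by rewrite mulrBl mul1r mulrBr mulr1 [- (a + _)]opprD addrA. Qed.

Lemma filt_muln m a k : J m a -> J m (a *+ k).
Proof. by move=> Ja; elim: k => [|k IH]; rewrite ?mulr0n // mulrS; apply: JD. Qed.

Lemma filt_exp m a k : J m a -> J (k.+1 * m) (a ^+ k.+1).
Proof.
move=> Ja; elim: k => [|k IH]; first by rewrite mul1n expr1.
by rewrite exprS mulSn; apply: JM.
Qed.

(** Meant for [a = e - 1] with [e] idempotent. Since [hom_to_U] only states multiplicativity, this
    is how the value at 1 is found to be the identity. *)
Lemma filt_idem a : J 1 a -> a = - (a * a) -> forall m, J m a.
Proof.
move=> J1 E; elim=> [|m IH]; first exact: Jle J1.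
by rewrite E; apply: JN; rewrite -addn1; apply: JM.
Qed.

Variables (d : nat) (phi : FG d -> T).
Hypotheses (phi1 : phi 1%g = 1)
  (phiM : forall x y, phi (x * y)%g = phi x * phi y)
  (phiJ : forall x, J 1 (phi x - 1)).

Definition cong m x := J m (phi x - 1).

Lemma cong1 m x : (m <= 1)%N -> cong m x.
Proof. by move=> m1; apply: Jle m1 (phiJ x). Qed.

Lemma cong_subgrp m : subgrp (cong m).
Proof.
rewrite /cong; split=> [|x y Hx Hy|x Hx]; first by rewrite phi1 subrr.
  have -> : phi (x * y)%g - 1 = phi x - 1 + (phi y - 1) + (phi x - 1) * (phi y - 1).
    rewrite phiM [(phi x - 1) * _]mulrBl mul1r -addrA [phi y - 1 + _]addrC subrK.
    by rewrite mulrBr mulr1 addrC addrA subrK.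
  by apply: JD; [apply: JD | apply: Jle (JM Hx Hy); rewrite leq_addr].
have E : phi x^-1%g * phi x = 1 by rewrite -phiM mulVg phi1.
have -> : phi x^-1%g - 1 = - (phi x - 1) - (phi x^-1%g - 1) * (phi x - 1).
  by rewrite mul_sub1 E [- (1 - _)]opprB [RHS]addrC [RHS]addrAC addrK.
apply: JD; apply: JN => //.
by apply: Jle (JM (phiJ _) Hx); rewrite leq_addl.
Qed.

(** With [A = phi x - 1] and [B = phi y - 1], one has [phi [x, y] - 1 = phi (y x)^-1 (A B - B
    A)]. *)
Lemma cong_comm m l x y : cong m x -> cong l y -> cong (m + l) [~ x, y]%g.
Proof.
rewrite /cong => Hx Hy; set c := phi [~ x, y]%g.
have Ec : phi (y * x)%g * c = phi (x * y)%g by rewrite -phiM -commgC.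
have E : phi (y * x)^-1%g * phi (y * x)%g = 1 by rewrite -phiM mulVg phi1.
pose A := phi x - 1; pose B := phi y - 1.
have -> : c - 1 = (A * B - B * A) + (phi (y * x)^-1%g - 1) * (A * B - B * A).
  rewrite mulrBl mul1r [RHS]addrC subrK.
  have -> : A * B - B * A = phi (x * y)%g - phi (y * x)%g.
    rewrite /A /B !mul_sub1 -!phiM [phi y + (_ - _)]addrCA.
    by rewrite [- (phi (y * x)%g - _)]opprB [LHS]addrA subrK.
  by rewrite mulrBr E -Ec mulrA E mul1r.
have AB : J (m + l) (A * B - B * A).
  by apply: JD; [apply: JM | apply: JN; rewrite addnC; apply: JM].
by apply: JD => //; apply: Jle (JM (phiJ _) AB); rewrite leq_addl.
Qed.

(** In the expansion of [(1 + N)^p] the middle terms are multiples of [p], and [N^p] lies in step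
    [p m]. The target [f] is left free to serve both the Zassenhaus and the p-central filtration. *)
Lemma cong_pow p m f x : prime p -> (forall a, J m a -> J f (a *+ p)) ->
  (f <= p * m)%N -> cong m x -> cong f (x ^+ p)%g.
Proof.
rewrite /cong => pp Jp fpm; set N := phi x - 1 => JNN.
have -> : phi (x ^+ p)%g = (1 + N) ^+ p.
  rewrite addrC subrK; elim: (p) => [|k IH]; first by rewrite expr0 -phi1.
  by rewrite expgS phiM IH exprS.
rewrite exprDn_comm; last exact: commr_sym (commr1 _).
case: p pp Jp fpm => // p pp Jp fpm.
rewrite big_ord_recl /= expr0 mulr1 expr1n bin0 addrC addKr.
rewrite big_ord_recr /=.
have bsum : forall (F : 'I_p -> T), (forall i, J f (F i)) -> J f (\sum_i F i).
  by move=> F HF; elim/big_ind: _ => // *; apply: JD.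
apply: JD; last first.
  by rewrite expr1n mul1r /bump /= add1n binn mulr1n; apply: Jle fpm (filt_exp _ JNN).
apply: bsum => i; rewrite /bump /= add1n expr1n mul1r.
have /dvdnP[c ->] : (p.+1 %| 'C(p.+1, i.+1))%N by apply: prime_dvd_bin; rewrite //= ltnS.
rewrite mulrnA; apply: Jp; apply: filt_muln.
by apply: Jle (filt_exp i JNN); rewrite mulSn leq_addr.
Qed.

Lemma commg_sub_cong m l (H K : FG d -> Prop) x :
  (forall y, H y -> cong m y) -> (forall y, K y -> cong l y) ->
  commg_sub H K x -> cong (m + l) x.
Proof.
move=> HH HK; apply: (gen_min (cong_subgrp _)) => _ [y [z [Hy [Hz ->]]]].
by rewrite fg_commE; apply: cong_comm; [apply: HH | apply: HK].
Qed.

Lemma lcs_cong m x : lcs m x -> cong m x.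
Proof.
elim: m x => [|[|m] IH] x; try by move=> _; apply: cong1.
by rewrite lcsSE // -[m.+2]addn1; apply: commg_sub_cong => // y _; apply: cong1.
Qed.

Lemma zass_cong p k m x : prime p -> (forall a : T, a *+ p = 0) -> (m <= k)%N ->
  zass_aux p k m x -> cong m x.
Proof.
move=> pp Tp; elim: k m x => [|k IH] m x mk /=.
  by move=> _; apply: cong1; apply: leq_trans mk _.
case: leqP => [m1 _|m1]; first exact: cong1.
apply: (gen_min (cong_subgrp _)) => {}x [|[i [j [i0 j0 ij]]]]; last first.
  rewrite -ij; apply: commg_sub_cong => y; apply: IH.
    by rewrite -ltnS; apply: leq_trans mk; rewrite -ij -addn1 leq_add2l.
  by rewrite -ltnS; apply: leq_trans mk; rewrite -ij -add1n leq_add2r.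
apply: (gen_min (cong_subgrp _)) => _ [y [Hy ->]]; rewrite fg_expE.
have p1 := prime_gt1 pp; have p0 := prime_gt0 pp.
(* [(m + p.-1) %/ p] is the ceiling of [m / p]; as [1 < m <= k.+1], it is at most [k], so the fuel
   suffices. *)
have cm : (m <= p * ((m + p.-1) %/ p))%N.
  have := ltn_ceil (m + p.-1) p0; rewrite mulSn mulnC; lia.
have cm' : ((m + p.-1) %/ p <= k)%N.
  rewrite -ltnS; apply: leq_trans mk; rewrite ltn_divLR //.
  by case: (p) p1 => [|[|r]] //= _; nia.
by apply: cong_pow (IH _ _ cm' Hy) => // a _; rewrite Tp.
Qed.

Lemma pcs_cong p m x : prime p ->
  (forall k a, (0 < k)%N -> J k a -> J k.+1 (a *+ p)) -> pcs p m x -> cong m x.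
Proof.
move=> pp Tp; elim: m x => [|[|m] IH] x; try by move=> _; apply: cong1.
have p1 := prime_gt1 pp.
apply: (gen_min (cong_subgrp _)) => {}x [|]; last first.
  by rewrite -[m.+2]addn1; apply: commg_sub_cong => // y _; apply: cong1.
apply: (gen_min (cong_subgrp _)) => _ [y [Hy ->]]; rewrite fg_expE.
apply: cong_pow (IH _ Hy) => // [a|]; first exact: Tp.
by apply: leq_trans (leq_mul p1 (leqnn _)); rewrite mul2n -addnn addSn ltnS leq_addl.
Qed.

End FilteredRing.

(** * Matrix filtrations from weights on the superdiagonals *)

Section MatrixFiltration.
Local Open Scope ring_scope.
Variables (R : comPzRingType) (n : nat) (q : nat -> nat -> R).
Hypotheses
  (qM : forall m l a b, (0 < a)%N -> (0 < b)%N ->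
     exists c, q m a * q l b = c * q (m + l) (a + b))
  (q_le : forall m k a, (m <= k)%N -> exists c, q k a = c * q m a)
  (q1 : forall a, (0 < a)%N -> q 1 a = 1).

(** [q m a] generates the ideal allowed in step [m] at distance [a] above the diagonal. The
    hypotheses on [q] make the steps multiplicative and decreasing, with all strictly upper
    triangular matrices in step 1. *)
Definition mxfilt (m : nat) (A : 'M[R]_n) : Prop :=
  forall i j : 'I_n, if (i < j)%N then exists c, A i j = c * q m (j - i) else A i j = 0.

Lemma mxfilt0 m : mxfilt m 0.
Proof. by move=> i j; case: ifP => _; rewrite mxE //; exists 0; rewrite mul0r. Qed.

Lemma mxfiltD m A B : mxfilt m A -> mxfilt m B -> mxfilt m (A + B).
Proof.
move=> HA HB i j; move: (HA i j) (HB i j); rewrite mxE; case: ifP => _.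
  by case=> a -> [b ->]; exists (a + b); rewrite mulrDl.
by move=> -> ->; rewrite addr0.
Qed.

Lemma mxfiltN m A : mxfilt m A -> mxfilt m (- A).
Proof.
move=> HA i j; move: (HA i j); rewrite mxE; case: ifP => _.
  by case=> a ->; exists (- a); rewrite mulNr.
by move=> ->; rewrite oppr0.
Qed.

Lemma mxfiltM m l A B : mxfilt m A -> mxfilt l B -> mxfilt (m + l) (A *m B).
Proof.
move=> HA HB i j; rewrite mxE.
have Z (k : 'I_n) : ~~ (i < k < j)%N -> A i k * B k j = 0.
  move: (HA i k) (HB k j); case: ifP => [_ _|_ ->]; last by rewrite mul0r.
  by case: ifP => // _ ->; rewrite mulr0.
case: ifP => ij; last by apply: big1 => k _; apply: Z; lia.
apply: (big_ind (fun x => exists c, x = c * q (m + l) (j - i))).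
- by exists 0; rewrite mul0r.
- by move=> _ _ [a ->] [b ->]; exists (a + b); rewrite mulrDl.
move=> k _; case: (boolP (i < k < j)%N) => [/andP[ik kj]|/Z->]; last first.
  by exists 0; rewrite mul0r.
move: (HA i k) (HB k j); rewrite ik kj => -[a ->] [b ->].
have [//||c E] := qM m l (_ : (0 < k - i)%N) (_ : (0 < j - k)%N); rewrite ?subn_gt0 //.
exists (a * b * c); rewrite mulrACA E mulrA; congr (_ * q _ _); lia.
Qed.

Lemma mxfilt_le m k A : (m <= k)%N -> mxfilt k A -> mxfilt m A.
Proof.
move=> mk HA i j; move: (HA i j); case: ifP => // _ [a ->].
by have [c ->] := q_le (j - i) mk; exists (a * c); rewrite mulrA.
Qed.

Lemma unitriangular_mxfilt A : unitriangular A -> mxfilt 1 (A - 1%:M).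
Proof.
case=> H0 H1 i j; rewrite !mxE; case: ltnP => ij.
  by exists (A i j - (i == j)%:R); rewrite q1 ?subn_gt0 // mulr1.
case: eqP => [->|/eqP ne]; first by rewrite H1 subrr.
by rewrite H0 ?subr0 // ltn_neqAle ij andbT eq_sym.
Qed.

End MatrixFiltration.

(** * Filtration by distance from the diagonal *)

Section DepthFiltration.
Local Open Scope ring_scope.
Variable R : comPzRingType.

(** This weight confines step [m] to entries at distance at least [m] above the diagonal, so step
    [n] is zero for size [n]. *)
Definition depth m a : R := (m <= a)%N%:R.

Lemma depthM m l a b : (0 < a)%N -> (0 < b)%N ->
  exists c, depth m a * depth l b = c * depth (m + l) (a + b).
Proof.
move=> _ _; exists (depth m a * depth l b); rewrite /depth.
case: leqP => ma; last by rewrite !mul0r.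
case: leqP => lb; last by rewrite mulr0 mul0r.
by rewrite leq_add // !mulr1.
Qed.

Lemma depth_le m k a : (m <= k)%N -> exists c, depth k a = c * depth m a.
Proof.
move=> mk; exists (depth k a); rewrite /depth; case: leqP => ka; last by rewrite mul0r.
by rewrite (leq_trans mk ka) mulr1.
Qed.

Lemma depth1 a : (0 < a)%N -> depth 1 a = 1.
Proof. by rewrite /depth => ->. Qed.

Lemma mxfilt_depth n (A : 'M[R]_n) : mxfilt depth n A -> A = 0.
Proof.
move=> HA; apply/matrixP => i j; move: (HA i j); rewrite mxE; case: ifP => // _ [c ->].
have := ltn_ord j; rewrite /depth => jn.
have -> : (n <= j - i)%N = false by lia.
by rewrite mulr0.
Qed.

End DepthFiltration.

(** * Filtration mixing distance and divisibility by p *)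

Section PadicFiltration.
Local Open Scope ring_scope.
Variables (R : comPzRingType) (p : nat).

(* Truncated subtraction: entries at distance at least [m] above the diagonal
   are unconstrained. *)
Definition pdepth m a : R := (p ^ (m - a))%N%:R.

Lemma pdepth_dvd (x : R) m k : (m <= k)%N ->
  exists c, x * (p ^ k)%N%:R = c * (p ^ m)%N%:R.
Proof.
by move=> mk; exists (x * (p ^ (k - m))%N%:R); rewrite -mulrA -natrM -expnD subnK.
Qed.

Lemma pdepthM m l a b : (0 < a)%N -> (0 < b)%N ->
  exists c, pdepth m a * pdepth l b = c * pdepth (m + l) (a + b).
Proof.
move=> _ _; rewrite -natrM -expnD -[_%:R]mul1r; apply: pdepth_dvd; lia.
Qed.

Lemma pdepth_le m k a : (m <= k)%N -> exists c, pdepth k a = c * pdepth m a.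
Proof. by move=> mk; rewrite -[pdepth k a]mul1r; apply: pdepth_dvd; lia. Qed.

Lemma pdepth1 a : (0 < a)%N -> pdepth 1 a = 1.
Proof. by case: a => // a _; rewrite /pdepth subSS sub0n expn0. Qed.

Lemma mxfilt_pdepthS n k (A : 'M[R]_n) : mxfilt pdepth k A -> mxfilt pdepth k.+1 (A *+ p).
Proof.
move=> HA i j; move: (HA i j); rewrite mulmxnE; case: ifP => [_|_ ->]; last by rewrite mul0rn.
case=> c ->; rewrite -mulr_natr -mulrA -natrM -expnSr; apply: pdepth_dvd; lia.
Qed.

End PadicFiltration.

(** * Unitriangular representations kill the filtration terms *)

Section Homs.
Local Open Scope ring_scope.
Variables (d : nat) (R : comPzRingType) (n : nat) (rho : FG d -> 'M[R]_n).
Hypothesis rho_hom : hom_to_U rho.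

Lemma hom_to_U1 : rho 1%g = 1.
Proof.
have [tri rhoM] := rho_hom.
apply/subr0_eq/(mxfilt_depth (R := R)); set N := rho 1%g - 1.
apply: (filt_idem (J := @mxfilt R n (depth R))).
- exact: mxfiltN.
- exact/mxfiltM/depthM.
- exact/mxfilt_le/depth_le.
- by apply: unitriangular_mxfilt (tri _); apply: depth1.
have E : rho 1%g * rho 1%g = rho 1%g by rewrite -[LHS]rhoM; congr rho; apply: mulg1.
by rewrite /N mul_sub1 E opprB addrAC subrr add0r.
Qed.

Lemma hom_to_U_lcs x : lcs n x -> rho x = 1.
Proof.
have [tri rhoM] := rho_hom => Hx; apply/subr0_eq/(mxfilt_depth (R := R)).
apply: (lcs_cong (J := @mxfilt R n (depth R))) Hx.
- exact: mxfilt0.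
- exact: mxfiltD.
- exact: mxfiltN.
- exact/mxfiltM/depthM.
- exact/mxfilt_le/depth_le.
- exact: hom_to_U1.
- exact: rhoM.
by move=> y; apply: unitriangular_mxfilt (tri _); apply: depth1.
Qed.

Lemma hom_to_U_zass p x : prime p -> p%:R = 0 :> R -> zass p n x -> rho x = 1.
Proof.
have [tri rhoM] := rho_hom => pp Rp Hx; apply/subr0_eq/(mxfilt_depth (R := R)).
apply: (zass_cong (J := @mxfilt R n (depth R)) _ _ _ _ _ _ _ _ pp _ (leqnn n) Hx).
- exact: mxfilt0.
- exact: mxfiltD.
- exact: mxfiltN.
- exact/mxfiltM/depthM.
- exact/mxfilt_le/depth_le.
- exact: hom_to_U1.
- exact: rhoM.
- by move=> y; apply: unitriangular_mxfilt (tri _); apply: depth1.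
by move=> A; apply/matrixP => i j; rewrite mulmxnE mxE -mulr_natr Rp mulr0.
Qed.

(** Distances from the diagonal are at most [n - 1], so entries in step [m] are multiples of
    [p^(m - (n - 1))]. For matrices of size [k + 1] this is [p^(m - k)], zero in [Z/p^(m - k)]. *)
Lemma hom_to_U_pcs p m x : prime p -> (p ^ (m - n.-1))%:R = 0 :> R -> pcs p m x -> rho x = 1.
Proof.
have [tri rhoM] := rho_hom => pp Rp Hx; apply/subr0_eq.
have : mxfilt (pdepth R p) m (rho x - 1).
  apply: (pcs_cong (J := @mxfilt R n (pdepth R p)) _ _ _ _ _ _ _ _ pp _ Hx).
  - exact: mxfilt0.
  - exact: mxfiltD.
  - exact: mxfiltN.
  - exact/mxfiltM/pdepthM.
  - exact/mxfilt_le/pdepth_le.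
  - exact: hom_to_U1.
  - exact: rhoM.
  - by move=> y; apply: unitriangular_mxfilt (tri _); apply: pdepth1.
  by move=> k A _; apply: mxfilt_pdepthS.
move=> HA; apply/matrixP => i j; move: (HA i j); case: ifP => [ij [c ->]|_ ->]; last by rewrite mxE.
have [|c' ->] := @pdepth_dvd R p c (m - n.-1) (m - (j - i)).
  by have := ltn_ord j; lia.
by rewrite Rp mulr0 mxE.
Qed.

End Homs.

(** * Magnus coefficients *)

Section Magnus.
Local Open Scope ring_scope.
Variable d : nat.
Notation word := (seq 'I_d).
Implicit Types (u v w : word) (f g : word -> int) (i j : 'I_d) (x y : FG d).

(* Power series in noncommuting variables X_i are represented by their
   coefficient functions; a letter acts by left multiplication by [1 + X_i] or
   by its inverse. *)
Fixpoint act_inv i f w : int :=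
  f w - (if w is j :: w' then (if j == i then act_inv i f w' else 0) else 0).

Definition act (l : letter d) f w : int :=
  if l.2 then f w + (if w is j :: w' then (if j == l.1 then f w' else 0) else 0)
  else act_inv l.1 f w.

Definition mag (s : seq (letter d)) : word -> int :=
  foldr act (fun w => (w == [::])%:R) s.

Definition eps x : word -> int := mag (val x).

Definition conv f g w : int := \sum_(k < (size w).+1) f (take k w) * g (drop k w).

Lemma eq_act l f g : f =1 g -> act l f =1 act l g.
Proof.
move=> E; case: l => i [] w; rewrite /act /=; first by case: w => [|j w]; rewrite !E.
by elim: w => [|j w IH] /=; rewrite ?IH !E.
Qed.

Lemma actK i f : act (i, true) (act (i, false) f) =1 f.
Proof. by case=> [|j w]; rewrite /act /= ?subr0 ?addr0 //; case: eqP => _; rewrite subrK. Qed.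

Lemma actVK i f : act (i, false) (act (i, true) f) =1 f.
Proof.
elim=> [|j w IH]; rewrite /act /= ?addr0 ?subr0 //.
by case: eqP => [_|_]; rewrite ?[act_inv _ _ _]IH ?addrK // subr0 addr0.
Qed.

Lemma act_flip l f : act l (act (flip l) f) =1 f.
Proof. by case: l => i []; [apply: actK | apply: actVK]. Qed.

Lemma eq_mag_red_step l s : mag (red_step l s) =1 act l (mag s).
Proof.
case: s => [|y s] w //=; case: eqP => [->|_] //=.
by rewrite act_flip.
Qed.

Lemma mag_reduce s : mag (reduce s) =1 mag s.
Proof. by elim: s => //= l s IH w; rewrite eq_mag_red_step; apply: eq_act. Qed.

Lemma eq_conv f f' g g' : f =1 f' -> g =1 g' -> conv f g =1 conv f' g'.
Proof. by move=> E E' w; apply: eq_bigr => k _; rewrite E E'. Qed.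

Lemma act_gen_conv i f g : act (i, true) (conv f g) =1 conv (act (i, true) f) g.
Proof.
case=> [|j w]; rewrite /act /conv /=; first by rewrite !addr0 !big_ord_recl !big_ord0 !addr0.
rewrite big_ord_recl [RHS]big_ord_recl -addrA /= addr0; congr (_ + _).
case: eqP => _; last by rewrite addr0; apply: eq_bigr => k _; rewrite addr0.
by rewrite -big_split; apply: eq_bigr => k _ /=; rewrite mulrDl.
Qed.

Lemma act_conv l f g : act l (conv f g) =1 conv (act l f) g.
Proof.
case: l => i [] w; first exact: act_gen_conv.
rewrite -[RHS](actVK i); apply: eq_act => {}w.
by rewrite act_gen_conv; apply: eq_conv => // v; rewrite actK.
Qed.

Lemma mag_cat s t : mag (s ++ t) =1 conv (mag s) (mag t).
Proof.
elim: s => [|l s IH] w /=; last by rewrite (eq_act _ IH) act_conv.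
rewrite /conv big_ord_recl take0 drop0 mul1r big1 ?addr0 // => k _.
by case: w k => [|a w] k; [case: k | rewrite mul0r].
Qed.

Lemma epsM x y w :
  eps (x * y)%g w = \sum_(k < (size w).+1) eps x (take k w) * eps y (drop k w).
Proof. by rewrite /eps [val _]/(reduce _) mag_reduce mag_cat. Qed.

Lemma eps1 w : eps 1%g w = (w == [::])%:R.
Proof. by []. Qed.

Lemma eps_nil x : eps x [::] = 1.
Proof.
rewrite /eps; elim: (val x) => //= -[i []] s; rewrite /act /= => ->; by rewrite ?addr0 ?subr0.
Qed.

Lemma eps_gen i w : eps (fg_gen i) w = ((w == [::]) || (w == [:: i]))%:R.
Proof.
rewrite /eps /= /act /=; case: w => [|j [|k w]] //=; rewrite ?add0r.
  by rewrite !eqseq_cons andbT; case: eqP.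
by rewrite !eqseq_cons andbF; case: eqP.
Qed.

(** * Unitriangular representations from the factors of a word *)

Section SliceRep.
Variables (R : comPzRingType) (n : nat) (w : word).
Hypothesis size_w : size w = n.

Definition slice_rep x : 'M[R]_n.+1 :=
  \matrix_(i, j) if (i <= j)%N then (eps x (take (j - i) (drop i w)))%:~R else 0.

(** Cutting the factor between positions [i] and [j] at each [k] with [i <= k <= j] turns the
    product rule [epsM] into matrix multiplication. *)
Lemma slice_rep_hom : hom_to_U slice_rep.
Proof.
split=> [x|x y].
  split=> [i j ji|i]; rewrite mxE; first by rewrite leqNgt ji.
  by rewrite leqnn subnn take0 eps_nil.
apply/matrixP => i j; rewrite !mxE.
pose F (k : nat) : R := (if (i <= k)%N then (eps x (take (k - i) (drop i w)))%:~R else 0) *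
            (if (k <= j)%N then (eps y (take (j - k) (drop k w)))%:~R else 0).
have -> : \sum_k slice_rep x i k * slice_rep y k j = \sum_(k < n.+1) F k.
  by apply: eq_bigr => k _; rewrite !mxE.
case: leqP => ij; last first.
  rewrite big1 // => k _; rewrite /F; case: leqP => ik; last by rewrite mul0r.
  by rewrite leqNgt (leq_trans ij ik) mulr0.
have su : size (take (j - i) (drop i w)) = (j - i)%N.
  by rewrite size_takel // size_drop size_w leq_sub2r // -ltnS.
rewrite [fg_mul x y]/(x * y)%g epsM su rmorph_sum /=.
rewrite -(big_mkord xpredT F) (@big_cat_nat _ _ _ i) //=; last exact: ltnW.
rewrite [X in _ = X + _]big_nat_cond [X in _ = X + _]big1 ?add0r; last first.
  by move=> k /andP[/andP[_ ki] _]; rewrite /F leqNgt ki mul0r.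
rewrite (@big_cat_nat _ _ _ j.+1) //=; last exact: leqW.
rewrite [X in _ = _ + X]big_nat_cond [X in _ = _ + X]big1 ?addr0; last first.
  by move=> k /andP[/andP[jk _] _]; rewrite /F [(k <= j)%N]leqNgt jk mulr0.
have -> : \sum_(i <= k < j.+1) F k = \sum_(k < (j - i).+1) F (k + i)%N.
  by rewrite -{1}[nat_of_ord i]add0n big_addn subSn // big_mkord.
apply: eq_bigr => k _; have := ltn_ord k; rewrite ltnS => kji.
rewrite /F leq_addl addnK rmorphM /=.
have -> : (k + i <= j)%N by lia.
congr (_%:~R * _%:~R); congr eps; first by rewrite take_takel.
by rewrite -drop_drop [take _ (drop k _)]take_drop; congr (drop _ (take _ _)); lia.
Qed.

End SliceRep.

Lemma eps_eq0 (R : comPzRingType) n x u : (0 < size u <= n)%N ->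
  (forall rho : FG d -> 'M[R]_n.+1, hom_to_U rho -> rho x = 1%:M) ->
  (eps x u)%:~R = 0 :> R.
Proof.
case: u => // i u /= su kill.
(* Padding the word to length [n] with its first letter keeps its coefficient in the first row, so
   one matrix size handles all shorter words. *)
pose w := i :: u ++ nseq (n - (size u).+1) i.
have sw : size w = n by rewrite /w /= size_cat size_nseq -addSn subnKC.
have := kill _ (slice_rep_hom R sw).
move/matrixP/(_ ord0 (inord (size u).+1)); rewrite !mxE inordK // subn0 drop0 /=.
by rewrite take_size_cat // -val_eqE /= inordK.
Qed.

(** The bound on [m] matters: ['Z_m] is Z/2 for [m] equal to 0 or 1. *)
Lemma intr_Zp_eq0 m (a : int) : (1 < m)%N -> (a%:~R == 0 :> 'Z_m) = (m %| a)%Z.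
Proof.
move=> m1; have nat_case k : (k%:R == 0 :> 'Z_m) = (m %| k)%N.
  by rewrite -val_eqE /= val_Zp_nat.
rewrite dvdzE; case: a => k; first exact: nat_case.
by rewrite NegzE mulrNz oppr_eq0 abszN; apply: nat_case.
Qed.

Lemma lcs_eps0 n x u : lcs n x -> (0 < size u < n)%N -> eps x u = 0.
Proof.
move=> Hx /andP[u0 un]; rewrite -(intz (eps x u)).
apply: (eps_eq0 (n := size u)) => [|rho Hrho]; first by rewrite u0 /=.
by apply: hom_to_U_lcs => //; apply: lcs_le Hx.
Qed.

Lemma zass_dvd_eps p n x u : prime p -> zass p n x -> (0 < size u < n)%N ->
  (p %| eps x u)%Z.
Proof.
move=> pp Hx; case: n Hx => [|n] Hx un; first by rewrite ltn0 andbF in un.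
rewrite (dvdz_pcharf (pchar_Fp pp)); apply/eqP.
apply: (eps_eq0 un) => rho Hrho.
by apply: (hom_to_U_zass Hrho pp) => //; apply: pchar_Fp_0.
Qed.

(** The matrix size [size u + 1] and the ring [Z/p^(n - size u)] both depend on the length of [u];
    for this pair [pcs p n] acts trivially. *)
Lemma pcs_dvd_eps p n x u : prime p -> pcs p n x -> (0 < size u < n)%N ->
  ((p ^ (n - size u))%N %| eps x u)%Z.
Proof.
move=> pp Hx /andP[u0 un].
have p1 : (1 < p ^ (n - size u))%N.
  by rewrite -{1}(exp1n (n - size u)) ltn_exp2r ?prime_gt1 // subn_gt0.
rewrite -intr_Zp_eq0 //; apply/eqP.
apply: (eps_eq0 (n := size u)) => [|rho Hrho]; first by rewrite u0 /=.
by apply: (hom_to_U_pcs Hrho pp _ Hx); apply: pchar_Zp.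
Qed.

End Magnus.

(** * Periodic extensions and leading words *)

Section Keys.
Variable d : nat.
Notation word := (seq 'I_d).
Implicit Types (u v w : word).

(** Base [d + 2] exceeds every digit, so words of equal length compare lexicographically, and it is
    at least 2 for every [d], so the denominators of [key] are positive on nonempty words. *)
Fixpoint wval w : nat := if w is i :: w' then i * d.+2 ^ size w' + wval w' else 0.

Lemma wval_cat u v : wval (u ++ v) = wval u * d.+2 ^ size v + wval v.
Proof.
elim: u => //= i u ->; rewrite size_cat expnD mulnDl mulnA addnA //.
Qed.

Lemma wval_lt w : wval w < d.+2 ^ size w.
Proof.
elim: w => //= i w IH; rewrite expnS.
apply: leq_trans (_ : i.+1 * d.+2 ^ size w <= _); first by rewrite mulSn addnC ltn_add2r.
by rewrite leq_mul2r; apply/orP; right; have := ltn_ord i; lia.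
Qed.

Lemma ltn_digits B a b a' b' : b < B -> b' < B ->
  (a * B + b < a' * B + b') = (a < a') || (a == a') && (b < b').
Proof.
move=> bB b'B; case: (ltngtP a a') => [lt|gt|->] /=; last by rewrite ltn_add2l.
  by have := leq_mul lt (leqnn B); rewrite mulSn; lia.
by have := leq_mul gt (leqnn B); rewrite mulSn; lia.
Qed.

Lemma wval_inj u v : size u = size v -> wval u = wval v -> u = v.
Proof.
elim: u v => [|i u IH] [|j v] //= [] suv E.
have L := wval_lt u; have L' := wval_lt v; rewrite suv in L E.
have := ltn_digits i j L L'; have := ltn_digits j i L' L; rewrite E ltnn => E1 E2.
have ij : i = j by apply/val_inj => /=; lia.
by rewrite ij (IH v) //; move: E; rewrite ij; lia.
Qed.

Lemma wval_take_drop a w : wval w = wval (take a w) * d.+2 ^ size (drop a w) + wval (drop a w).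
Proof. by rewrite -wval_cat cat_take_drop. Qed.

Lemma wval_lt_cat u v w : size w = size u + size v -> wval w < wval (u ++ v) ->
  wval (take (size u) w) < wval u \/
  take (size u) w = u /\ wval (drop (size u) w) < wval v.
Proof.
move=> sw; have sd : size (drop (size u) w) = size v by rewrite size_drop sw addKn.
have st : size (take (size u) w) = size u by rewrite size_takel // sw leq_addr.
rewrite (wval_take_drop (size u) w) wval_cat sd ltn_digits ?wval_lt //; last first.
  by rewrite -sd wval_lt.
by case/orP=> [|/andP[/eqP E]]; [left | right; split=> //; apply: wval_inj].
Qed.

Local Open Scope ring_scope.

(* [key u] is the value of the infinite periodic word [u u u ...], read as a
   fraction in base d+2; concatenation takes mediants of keys. *)
Definition key u : rat := (wval u)%:R / (d.+2 ^ size u - 1)%:R.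

Lemma base_gt1 u : u != [::] -> (1 < d.+2 ^ size u)%N.
Proof. by case: u => // i u _; rewrite /= expnS (leq_trans _ (leq_pmulr _ _)) ?expn_gt0. Qed.

(** Clear denominators and add [wval u + wval v] to both sides. *)
Lemma key_ltE u v : u != [::] -> v != [::] ->
  (key u < key v) = (wval (u ++ v) < wval (v ++ u))%N.
Proof.
move=> /base_gt1 u0 /base_gt1 v0.
rewrite /key ltr_pdivrMr ?ltr0n ?subn_gt0 // mulrAC ltr_pdivlMr ?ltr0n ?subn_gt0 //.
by rewrite -!natrM ltr_nat !wval_cat !mulnBr !muln1; have := leq_pmulr; nia.
Qed.

Lemma key_eqE u v : u != [::] -> v != [::] -> (key u == key v) = (u ++ v == v ++ u).
Proof.
move=> u0 v0; rewrite eq_le !leNgt !key_ltE //; apply/idP/eqP => [|->]; last by rewrite ltnn.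
rewrite -!leqNgt -eqn_leq => /eqP E; apply: wval_inj; last by [].
by rewrite !size_cat addnC.
Qed.

Lemma key_cat_lt u v : u != [::] -> v != [::] -> key u < key v -> key (u ++ v) < key v.
Proof.
move=> u0 v0; have uv0 : u ++ v != [::] by case: u u0.
rewrite !key_ltE // -catA !wval_cat !size_cat !expnD => lt.
have B0 : (0 < d.+2 ^ size v)%N by rewrite expn_gt0.
move: lt; rewrite -(ltn_pmul2r B0).
move: (expn _ _) (expn _ _) (wval u) (wval v) => A B a b; nia.
Qed.

Lemma key_cat_eq u v : u != [::] -> v != [::] -> key u = key v -> key (u ++ v) = key v.
Proof.
move=> u0 v0 /eqP; rewrite key_eqE // => /eqP E; apply/eqP.
have uv0 : u ++ v != [::] by case: u u0 {E}.
by rewrite key_eqE // {1}E -catA.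
Qed.

Lemma key_lt2 u : u != [::] -> key u < 2.
Proof.
move=> /base_gt1 u0; rewrite /key ltr_pdivrMr ?ltr0n ?subn_gt0 // -natrM ltr_nat.
have := wval_lt u; lia.
Qed.

(** The two words commute by [key_eqE], so both end their common product. *)
Lemma key_eq_suffix u v : u != [::] -> v != [::] -> key u = key v -> suffix u v || suffix v u.
Proof.
move=> u0 v0 /eqP; rewrite key_eqE // => /eqP E.
have S (a b : word) : a ++ b = b ++ a -> (size a <= size b)%N -> suffix a b.
  move=> Eab ab; have : suffix a (a ++ b) by rewrite Eab suffix_suffix.
  rewrite !suffixE size_cat addKn drop_cat; case: ltnP => [lt|ge].
    by move: lt => /ltn_geF; rewrite ab.
  done.
by case/orP: (leq_total (size u) (size v)) => /S ->; rewrite ?orbT.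
Qed.

End Keys.

(** * Leading words of commutators *)

Section Leads.
Variable d : nat.
Local Open Scope ring_scope.
Notation word := (seq 'I_d).
Implicit Types (u v w : word) (x y : FG d).

Definition lead x u := [/\ u != [::], lcs (size u) x, eps x u = 1
  & forall w, size w = size u -> (wval w < wval u)%N -> eps x w = 0].

Lemma lead_gen (i : 'I_d) : lead (fg_gen i) [:: i].
Proof.
split=> // [|w]; first by rewrite eps_gen eqxx.
by case: w => [|j [|k w]] //= _; rewrite eps_gen orFb; case: eqP => // -[->]; rewrite ltnn.
Qed.

Lemma epsM_ends x y w : w != [::] ->
  eps (x * y)%g w = eps x w + eps y w +
    \sum_(k < (size w).-1) eps x (take k.+1 w) * eps y (drop k.+1 w).
Proof.
case: w => // i w _; rewrite epsM [size _]/= big_ord_recl big_ord_recr [(_.+1).-1]/=.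
rewrite [drop _ _]/= [take _ _]/= eps_nil mul1r.
have -> : lift ord0 (@ord_max (size w)) = (size w).+1 :> nat by [].
rewrite take_oversize // drop_oversize // eps_nil mulr1.
by rewrite [X in _ + X]addrC addrA [eps y _ + _]addrC.
Qed.

Lemma eps_take_drop a w x y :
  (forall k, (0 < k < size w)%N -> k != a -> eps x (take k w) * eps y (drop k w) = 0) ->
  (0 < a < size w)%N ->
  eps (x * y)%g w = eps x w + eps y w + eps x (take a w) * eps y (drop a w).
Proof.
move=> Z /andP[a0 aw]; have w0 : w != [::] by case: w aw {Z}.
have a1 : (a.-1 < (size w).-1)%N by lia.
rewrite epsM_ends // (bigD1 (Ordinal a1)) //= prednK // big1 ?addr0 // => k ka.
have := ltn_ord k; move: ka; rewrite -val_eqE /= => ka kw; apply: Z; lia.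
Qed.

Lemma epsM_low x y w :
  (forall k, (0 < k < size w)%N -> eps x (take k w) * eps y (drop k w) = 0) ->
  w != [::] -> eps (x * y)%g w = eps x w + eps y w.
Proof.
move=> Z w0; rewrite epsM_ends // big1 ?addr0 // => k _; apply: Z.
have := ltn_ord k; lia.
Qed.

(** A cut before [a] leaves too short a prefix for [x], a cut after [a] too short a suffix for [y];
    only the cut at [a] survives. *)
Lemma eps_mul_lcs a b w x y : (0 < a)%N -> (0 < b)%N -> size w = (a + b)%N ->
  lcs a x -> lcs b y ->
  eps (x * y)%g w = eps x w + eps y w + eps x (take a w) * eps y (drop a w).
Proof.
move=> a0 b0 sw Hx Hy; apply: eps_take_drop => [k kw ka|]; last by lia.
have [lt|ge] := ltnP k a.
  suff -> : eps x (take k w) = 0 by rewrite mul0r.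
  by apply: (lcs_eps0 Hx); rewrite size_takel; lia.
suff -> : eps y (drop k w) = 0 by rewrite mulr0.
by apply: (lcs_eps0 Hy); rewrite size_drop; lia.
Qed.

(** Compare coefficients in [x y = (y x) [x, y]]: as [[x, y]] lies in [lcs (a + b)], it adds only
    its own coefficient at this length. *)
Lemma eps_comm a b w x y : (0 < a)%N -> (0 < b)%N -> size w = (a + b)%N ->
  lcs a x -> lcs b y ->
  eps [~ x, y]%g w = eps x (take a w) * eps y (drop a w) - eps y (take b w) * eps x (drop b w).
Proof.
move=> a0 b0 sw Hx Hy.
have := congr1 (fun z => eps z w) (commgC x y) => /=.
have w0 : w != [::] by case: w sw => //; move: a0; case: (a).
rewrite (eps_mul_lcs a0 b0 sw) // [eps (_ * [~ x, y])%g w]epsM_low //; last first.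
  move=> k kw; suff -> : eps [~ x, y]%g (drop k w) = 0 by rewrite mulr0.
  by apply: (lcs_eps0 (lcs_comm a0 b0 Hx Hy)); rewrite size_drop; lia.
rewrite (eps_mul_lcs b0 a0 _ Hy Hx) 1?addnC //; lra.
Qed.

(** By [eps_comm] the lowest part of [[y, x]] is a difference of two products with least words [v u]
    and [u v]. The key inequality makes [v u] the smaller, so it leads with coefficient 1. *)
Lemma lead_comm x y u v : lead y v -> lead x u -> key v < key u -> lead [~ y, x]%g (v ++ u).
Proof.
move=> [v0 Hy y1 yl] [u0 Hx x1 xl]; rewrite key_ltE // => vu.
have sv : (0 < size v)%N by rewrite lt0n size_eq0.
have su : (0 < size u)%N by rewrite lt0n size_eq0.
have prodl (x' y' : FG d) (a b w : word) : size w = (size a + size b)%N ->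
   (forall w', size w' = size a -> (wval w' < wval a)%N -> eps x' w' = 0) ->
   (forall w', size w' = size b -> (wval w' < wval b)%N -> eps y' w' = 0) ->
   (wval w < wval (a ++ b))%N ->
   eps x' (take (size a) w) * eps y' (drop (size a) w) = 0.
  move=> sw Hx' Hy' /(wval_lt_cat sw)[lt|[_ lt]].
    by rewrite Hx' ?mul0r // size_takel // sw leq_addr.
  by rewrite Hy' ?mulr0 // size_drop sw addKn.
split.
- by case: v v0 {Hy y1 yl vu sv}.
- by rewrite size_cat; apply: lcs_comm.
- rewrite (eps_comm sv su) ?size_cat // take_size_cat // drop_size_cat // y1 x1 mulr1.
  by rewrite (prodl x y u v) ?subr0 // size_cat addnC.
move=> w; rewrite size_cat => sw wl; rewrite (eps_comm sv su) //.
rewrite (prodl y x v u) // (prodl x y u v) ?subr0 //; first by rewrite addnC.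
exact: ltn_trans vu.
Qed.

End Leads.

(** * Lazard elimination *)

Lemma max_key (T : eqType) (f : T -> rat) (s : seq T) : s != [::] ->
  exists2 p, p \in s & {in s, forall q, (f q <= f p)%R}.
Proof.
elim: s => // a [|b s] IH _.
  by exists a; rewrite ?mem_head // => q; rewrite inE => /eqP->.
have [//|p ps pm] := IH; case: (lerP (f p) (f a)) => pa.
  exists a; rewrite ?mem_head // => q; rewrite inE => /predU1P[->//|/pm qp].
  exact: le_trans pa.
exists p; first by rewrite inE ps orbT.
by move=> q; rewrite inE => /predU1P[->|/pm//]; apply: ltW.
Qed.

Section Elimination.
Variable d : nat.
Local Open Scope group_scope.
Notation word := (seq 'I_d).
Implicit Types (u v w : word) (x y z g h t : FG d).

Lemma suffix_linear (a c e : word) :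
  suffix a e -> suffix c e -> (size a <= size c)%N -> suffix a c.
Proof.
case/suffixP=> a' -> /suffixP[c' E] ac.
have ca : (size c' <= size a')%N.
  by rewrite -(leq_add2r (size a)) -[leqRHS]size_cat E size_cat leq_add2l.
move/eqP: E; rewrite -[a'](cat_take_drop (size c')) -catA eqseq_cat ?size_takel //.
by case/andP=> _ /eqP <-; apply: suffix_suffix.
Qed.

(** The words form a suffix code. By [key_eq_suffix] their keys are distinct, so the largest key is
    attained only once. *)
Definition code n (X : seq (FG d * word)) :=
  {in X, forall p, lead p.1 p.2 /\ size p.2 < n} /\
  {in X &, forall p q, suffix p.2 q.2 -> p = q}.

Definition letters_and_lcs n (X : seq (FG d * word)) : FG d -> Prop :=
  gen (fun z => z \in map fst X \/ lcs n z).

(** * Eliminating the generator with the largest key *)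

Section Step.
Variables (n : nat) (X : seq (FG d * word)) (x : FG d) (u : word).
Hypotheses (codeX : code n X) (xuX : (x, u) \in X)
  (key_max : {in X, forall q, (key q.2 <= key u)%R}).

Definition bracket y k := iter k (fun z => [~ z, x]) y.
Definition bracket_word v k := iter k (fun w => w ++ u) v.

(** Brackets whose words reach length [n] lie in [lcs n] and are dropped; each bracketing lengthens
    the word, so [k < n] exhausts the others. *)
Definition elim_code := [seq r <- [seq (bracket q.1 k, bracket_word q.2 k)
   | q <- [seq q <- X | q != (x, u)], k <- iota 0 n] | size r.2 < n].

Lemma lead_xu : lead x u. Proof. by have [/(_ _ xuX)[]] := codeX. Qed.

Lemma key_lt_max q : q \in X -> q != (x, u) -> (key q.2 < key u)%R.
Proof.
move=> qX qne; rewrite lt_neqAle key_max // andbT; apply/eqP => E.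
have [leadX sufX] := codeX; have [[u0 _ _ _] _] := leadX _ xuX.
have [[q0 _ _ _] _] := leadX _ qX.
case/orP: (key_eq_suffix q0 u0 E) => [/(sufX q (x, u) qX xuX)|/(sufX (x, u) q xuX qX)] Eq.
  by rewrite Eq eqxx in qne.
by rewrite Eq eqxx in qne.
Qed.

(** The key stays strictly below [key u] after each bracketing, which is what [lead_comm] requires
    for the next one. *)
Lemma bracket_lead q k : q \in X -> q != (x, u) ->
  lead (bracket q.1 k) (bracket_word q.2 k) /\ (key (bracket_word q.2 k) < key u)%R.
Proof.
move=> qX qne; have [leadX _] := codeX; have [u0 _ _ _] := lead_xu.
elim: k => [|k [IH1 IH2]] /=; first by split; [have [] := leadX _ qX | apply: key_lt_max].
split; first by apply: lead_comm => //; apply: lead_xu.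
by apply: key_cat_lt => //; have [] := IH1.
Qed.

Lemma size_bracket_word v k : v != [::] -> (k < size (bracket_word v k))%N.
Proof.
move=> v0; have [u0 _ _ _] := lead_xu; have su : (0 < size u)%N by rewrite lt0n size_eq0.
by elim: k => [|k IH] /=; rewrite ?lt0n ?size_eq0 // size_cat; lia.
Qed.

Lemma mem_elim_code q k : q \in X -> q != (x, u) -> (size (bracket_word q.2 k) < n)%N ->
  (bracket q.1 k, bracket_word q.2 k) \in elim_code.
Proof.
move=> qX qne sn; rewrite mem_filter sn andTb; apply/allpairsP; exists (q, k); split=> //=.
  by rewrite mem_filter qne.
have [leadX _] := codeX; have [[q0 _ _ _] _] := leadX _ qX.
by rewrite mem_iota add0n (leq_trans (size_bracket_word k q0)) // ltnW.
Qed.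

Lemma elim_codeP r : r \in elim_code -> exists q k,
  [/\ q \in X, q != (x, u), r = (bracket q.1 k, bracket_word q.2 k) & (size r.2 < n)%N].
Proof.
rewrite mem_filter => /andP[sr /allpairsP[[q k] /= [qX _ E]]].
by move: qX; rewrite mem_filter => /andP[qne qX]; exists q, k.
Qed.

(** Cancel trailing copies of [u] on both sides; if one side runs out first, [u] and another code
    word are comparable as suffixes, which the code property excludes. *)
Lemma suffix_bracket q k q' k' : q \in X -> q != (x, u) -> q' \in X -> q' != (x, u) ->
  suffix (bracket_word q.2 k) (bracket_word q'.2 k') -> q = q' /\ k = k'.
Proof.
move=> qX qne q'X q'ne; have [_ sufX] := codeX.
elim: k k' => [|k IH] [|k'] /=.
- by move/(sufX _ _ qX q'X).
- set b := bracket_word _ _ => sq; have su : suffix u (b ++ u) by apply: suffix_suffix.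
  suff : suffix q.2 u || suffix u q.2.
    by case/orP=> [/(sufX q (x, u) qX xuX)|/(sufX (x, u) q xuX qX)] E; rewrite E eqxx in qne.
  case/orP: (leq_total (size q.2) (size u)) => le.
    by rewrite (suffix_linear sq su le).
  by rewrite (suffix_linear su sq le) orbT.
- move=> sq; have := suffix_trans (suffix_suffix (bracket_word q.2 k) u) sq.
  by move/(sufX (x, u) q' xuX q'X) => E; rewrite -E eqxx in q'ne.
by rewrite suffix_catl // eqxx /= => /IH[-> ->].
Qed.

Lemma elim_code_code : code n elim_code.
Proof.
split=> [r /elim_codeP[q [k [qX qne -> sr]]]|].
  by have [] := bracket_lead k qX qne.
move=> _ _ /elim_codeP[q [k [qX qne -> _]]] /elim_codeP[q' [k' [q'X q'ne -> _]]].
by case/(suffix_bracket qX qne q'X q'ne) => -> ->.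
Qed.

Lemma elim_code_key : {in elim_code, forall r, (key r.2 < key u)%R}.
Proof. by move=> r /elim_codeP[q [k [qX qne -> _]]]; have [] := bracket_lead k qX qne. Qed.

Let H := letters_and_lcs n elim_code.

Lemma lcs_elim h : lcs n h -> H h.
Proof. by move=> Hh; apply: gen_in; right. Qed.

Lemma bracket_elim q k : q \in X -> q != (x, u) -> H (bracket q.1 k).
Proof.
move=> qX qne; have [lt|ge] := ltnP (size (bracket_word q.2 k)) n.
  by apply: gen_in; left; apply/mapP; exists (bracket q.1 k, bracket_word q.2 k);
    first exact: mem_elim_code.
by apply: lcs_elim; apply: lcs_le ge _; have [[]] := bracket_lead k qX qne.
Qed.

Lemma elim_conj h : H h -> H (h ^ x) /\ H (h ^ x^-1).
Proof.
have [H1 HM HV] : subgrp H by apply: gen_subgrp.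
apply: (gen_min (H := fun h => H (h ^ x) /\ H (h ^ x^-1))).
  split=> [|a b [? ?] [? ?]|a [? ?]]; rewrite ?conj1g ?conjMg ?conjVg; split=> //;
    by [apply: HM | apply: HV].
move=> {}h [/mapP[r /elim_codeP[q [k [qX qne -> _]]] ->]|Hh]; last first.
  by split; apply: lcs_elim; apply: lcs_normalized.
split=> /=.
  rewrite [_ ^ x](_ : _ = bracket q.1 k * bracket q.1 k.+1); last by rewrite /= commgEl mulVKg.
  by apply: (HM); apply: bracket_elim.
(* Descending induction on [k]: conjugation by [x^-1] involves the next bracket, and from [k = n] on
   the brackets lie in [lcs n]. *)
have [m] := ubnP (n - k); elim: m k => // m IH k; rewrite ltnS => nk.
have [lt|ge] := ltnP k n; last first.
  apply: lcs_elim; apply: lcs_normalized; apply: lcs_le ge _.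
  have [[q0 Hq _ _] _] := bracket_lead k qX qne; apply: lcs_le Hq; apply: ltnW.
  by apply: size_bracket_word; have [/(_ _ qX)[[]]] := codeX.
have -> : bracket q.1 k ^ x^-1 = bracket q.1 k * (bracket q.1 k.+1 ^ x^-1)^-1.
  rewrite /= commgEl conjMg conjVg -conjgM mulgV conjg1 invgM invgK mulVKg //.
apply: HM; first exact: bracket_elim.
by apply: HV; apply: IH; lia.
Qed.

(** Since [x] normalizes [H], the products of a power of [x] and an element of [H] form a subgroup,
    and it contains all generators. *)
Lemma elim_step g : letters_and_lcs n X g -> exists2 t, gen (eq x) t & H (t^-1 * g).
Proof.
have [H1 HM HV] : subgrp H by apply: gen_subgrp.
have [C1 CM CV] : subgrp (gen (eq x)) by apply: gen_subgrp.
have HC t : gen (eq x) t -> forall h, H h -> H (h ^ t) /\ H (h ^ t^-1).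
  apply: (gen_min (H := fun t => forall h, H h -> H (h ^ t) /\ H (h ^ t^-1))).
    split=> [h Hh|a b Ha Hb h Hh|a Ha h Hh].
    - by rewrite invg1 conjg1.
    - rewrite invgM !conjgM; split; first by apply: (Hb _ _).1; apply: (Ha _ _).1.
      by apply: (Ha _ _).2; apply: (Hb _ _).2.
    - by rewrite invgK; have [] := Ha h Hh.
  by move=> _ <- h; apply: elim_conj.
apply: (gen_min (H := fun g => exists2 t, gen (eq x) t & H (t^-1 * g))).
  split=> [|a b [t Ct Ht] [t' Ct' Ht']|a [t Ct Ht]].
  - by exists 1; rewrite ?mulg1 ?invg1.
  - exists (t * t'); first exact: CM.
    rewrite (_ : _ * _ = (t^-1 * a) ^ t' * (t'^-1 * b)).
      by apply: HM => //; apply: (HC _ Ct' _ Ht).1.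
    by rewrite /conjg invgM !mulgA mulgK.
  - exists t^-1; first exact: CV.
    rewrite (_ : _ * _ = ((t^-1 * a)^-1) ^ t^-1); last first.
      by rewrite /conjg invgM !invgK !mulgA mulgK.
    by apply: (HC _ Ct _ _).2; apply: HV.
move=> {}g [/mapP[q qX ->]|Hg]; last by exists 1; rewrite ?invg1 ?mul1g //; apply: lcs_elim.
have [->|qne] := eqVneq q (x, u).
  by exists x; rewrite ?mulVg //; apply: gen_in.
by exists 1; rewrite ?invg1 ?mul1g //; apply: (bracket_elim 0 qX qne).
Qed.

End Step.

Definition normal_form n (K : rat) (s : seq (FG d * (FG d * word))) :=
  {in s, forall r, [/\ gen (eq r.2.1) r.1, lead r.2.1 r.2.2, (size r.2.2 < n)%N
                     & (key r.2.2 < K)%R]} /\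
  uniq [seq key r.2.2 | r <- s].

(** Termination measure of the elimination: lowering the bound from [K] to [key u] removes at least
    [u] from the count. *)
Definition short_words n (K : rat) := #|[pred w : n.-bseq 'I_d | (key w < K)%R]|.

(** Split off a power of the generator with the largest key and recurse on the elimination code; its
    keys are all smaller, so the keys along the product are distinct. *)
Lemma lazard_elimination n X K g : code n X ->
  {in X, forall p, (key p.2 < K)%R} -> letters_and_lcs n X g ->
  exists2 s, normal_form n K s & exists2 h, lcs n h & g = (\prod_(r <- s) r.1) * h.
Proof.
have [m] := ubnP (short_words n K); elim: m X K g => // m IH X K g; rewrite ltnS => Km cX kX.
have [->|X0] := eqVneq X [::].
  move=> Hg; exists [::] => //; exists g; last by rewrite big_nil mul1g.
  by move: g Hg; apply: (gen_min (@lcs_subgrp d n)) => z [].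
have [[x u] xuX kmax] := max_key (fun p : FG d * word => key p.2) X0.
move=> /(elim_step cX xuX kmax)[t Ct Ht].
have kuK : (key u < K)%R by exact: kX _ xuX.
have [lxu un] : lead x u /\ (size u < n)%N by have [/(_ _ xuX)] := cX.
have [] := IH (elim_code n X x u) (key u) (t^-1 * g) => //.
- apply: leq_trans Km; apply: proper_card; apply/properP; split.
    by apply/subsetP => w; rewrite !inE => /lt_trans; apply.
  exists (Bseq (ltnW un)); first by rewrite inE.
  by rewrite inE ltxx.
- exact: elim_code_code.
- exact: elim_code_key.
move=> s [sP us] [h Hh E]; exists ((t, (x, u)) :: s); last first.
  by exists h => //; rewrite big_cons -mulgA -E mulVKg.
split=> [r|/=].
  rewrite inE => /predU1P[->//|/sP[? ? ? lt]]; split=> //; exact: lt_trans kuK.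
rewrite us andbT; apply/mapP => -[r /sP[_ _ _ lt] Er].
by rewrite -Er ltxx in lt.
Qed.

Lemma gen_letters g : gen (fun z => exists i, z = fg_gen i) g.
Proof.
have [H1 HM HV] := gen_subgrp (fun z : FG d => exists i, z = fg_gen i).
have Hl (l : letter d) : gen (fun z : FG d => exists i, z = fg_gen i) (exist _ [:: l] isT).
  case: l => i []; first by apply: gen_in; exists i; apply: val_inj.
  suff -> : exist _ [:: (i, false)] isT = fg_inv (fg_gen i).
    by apply: gen_inv; apply: gen_in; exists i.
  exact: val_inj.
case: g; elim=> [|l s IH] rs.
  by rewrite (_ : exist _ _ _ = fg_one d) //; apply: val_inj.
have rs' := path_sorted rs.
rewrite (_ : exist _ _ _ = fg_mul (exist _ [:: l] isT) (exist _ s rs')); last first.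
  by apply: val_inj; rewrite /= -[RHS]/(reduce (l :: s)) reduce_id.
by apply: gen_mul => //; apply: IH.
Qed.

Lemma magnus_normal_form n g : (1 < n)%N ->
  exists2 s, normal_form n 2 s & exists2 h, lcs n h & g = (\prod_(r <- s) r.1) * h.
Proof.
move=> n1; pose X := [seq (fg_gen i, [:: i]) | i <- enum 'I_d].
apply: (@lazard_elimination n X).
- split=> [_ /mapP[i _ ->]|_ _ /mapP[i _ ->] /mapP[j _ ->]] /=.
    by split; first exact: lead_gen.
  by rewrite suffixE /= => /eqP[->].
- by move=> _ /mapP[i _ ->]; apply: key_lt2.
apply: genS (gen_letters g) => _ [i ->]; left; rewrite -map_comp.
by apply/mapP; exists i; rewrite ?mem_enum.
Qed.

End Elimination.

(** * Detection of filtration terms by Magnus coefficients *)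

Lemma uniq_map_inj (T1 T2 : eqType) (f : T1 -> T2) (s : seq T1) :
  uniq (map f s) -> {in s &, injective f}.
Proof.
elim: s => // a s IH /= /andP[as_ us] b c; rewrite !inE.
case/predU1P=> [->|bs] /predU1P[->|cs] // E; last exact: IH.
- by rewrite E map_f in as_.
- by rewrite -E map_f in as_.
Qed.

Section Congruences.
Variables (d : nat) (q : nat -> nat).
Local Open Scope ring_scope.
Notation word := (seq 'I_d).
Implicit Types (u v w : word) (x y t : FG d).
Hypothesis qM : forall a b, (0 < a)%N -> (0 < b)%N -> (q (a + b) %| q a * q b)%N.

(** The weights to be used are 0 for [lcs] (divisibility by 0 being vanishing), [p] for [zass], and
    [p^(n - k)] at length [k] for [pcs]. *)
Definition low m x := forall w, (0 < size w < m)%N -> (q (size w) %| eps x w)%Z.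

Lemma low_le m k x : (m <= k)%N -> low k x -> low m x.
Proof. by move=> mk lx w /andP[w0 wm]; apply: lx; rewrite w0 (leq_trans wm). Qed.

Lemma low_eps1 w m : (0 < size w)%N -> (q m %| eps (1%g : FG d) w)%Z.
Proof. by case: w => // i w _; rewrite eps1 dvdz0. Qed.

Lemma low1 m : low m 1%g.
Proof. by move=> w /andP[w0 _]; apply: low_eps1. Qed.

(** Cross terms involve only proper factors of [w], so lowness below length [m] gives additivity at
    length [m] as well. *)
Lemma low_mul_eps m x y w : low m x -> low m y -> (0 < size w <= m)%N ->
  (q (size w) %| eps (x * y)%g w - (eps x w + eps y w))%Z.
Proof.
move=> lx ly /andP[w0 wm]; rewrite epsM_ends; last by case: w w0 {wm}.
rewrite addrAC subrr add0r; apply: rpred_sum => k _; have := ltn_ord k => kw.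
have st : size (take k.+1 w) = k.+1 by rewrite size_takel //; lia.
have sd : size (drop k.+1 w) = (size w - k.+1)%N by rewrite size_drop.
have H1 : (q k.+1 %| eps x (take k.+1 w))%Z by have := lx (take k.+1 w); rewrite st; apply; lia.
have H2 : (q (size w - k.+1) %| eps y (drop k.+1 w))%Z.
  by have := ly (drop k.+1 w); rewrite sd; apply; lia.
apply: dvdz_trans (dvdz_mul H1 H2).
have := @qM k.+1 (size w - k.+1) isT; rewrite subnKC; last by lia.
by rewrite -PoszM; apply; lia.
Qed.

Lemma lowM m x y : low m x -> low m y -> low m (x * y)%g.
Proof.
move=> lx ly w wm; rewrite -[eps _ _](subrK (eps x w + eps y w)).
apply: rpredD; last apply: rpredD.
- by apply: (low_mul_eps lx ly); lia.
- exact: lx.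
- exact: ly.
Qed.

Lemma low_mulV_eps m x w : low m x -> low m x^-1%g -> (0 < size w <= m)%N ->
  (q (size w) %| eps x^-1%g w + eps x w)%Z.
Proof.
move=> lx lV wm; have := low_mul_eps lV lx wm; rewrite mulVg => H.
rewrite -[X in (_ %| X)%Z](subKr (eps 1%g w)); apply: rpredB => //.
by apply: low_eps1; lia.
Qed.

Lemma lowV m x : low m x -> low m x^-1%g.
Proof.
move=> lx; elim: m lx => [|m IH] lx w; first by rewrite andbF.
have lx' : low m x by move=> u um; apply: lx; lia.
move=> wm; rewrite -[eps _ _](addrK (eps x w)); apply: rpredB; last exact: lx.
by apply: (low_mulV_eps lx' (IH lx')); lia.
Qed.

Lemma low_exp_eps m x k w : low m x -> (0 < size w <= m)%N ->
  low m (x ^+ k)%g /\ (q (size w) %| eps (x ^+ k)%g w - k%:R * eps x w)%Z.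
Proof.
move=> lx wm; elim: k => [|k [IH1 IH2]].
  by rewrite mul0r subr0; split; [apply: low1 | apply: low_eps1; lia].
rewrite expgS; split; first exact: lowM.
have := rpredD (low_mul_eps lx IH1 wm) IH2; rewrite -natr1.
rewrite [X in X \in _ -> _](_ : _ = eps (x * x ^+ k)%g w - (k%:R + 1) * eps x w) //; ring.
Qed.

Lemma low_prod_eps m (I : eqType) (s : seq I) (F : I -> FG d) w :
  {in s, forall i, low m (F i)} -> (0 < size w <= m)%N ->
  low m (\prod_(i <- s) F i)%g /\
  (q (size w) %| eps (\prod_(i <- s) F i)%g w - \sum_(i <- s) eps (F i) w)%Z.
Proof.
move=> + wm; elim: s => [|i s IH] ls.
  by rewrite !big_nil subr0; split; [apply: low1 | apply: low_eps1; lia].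
have li : low m (F i) by apply: ls; rewrite mem_head.
have [|IH1 IH2] := IH; first by move=> j js; apply: ls; rewrite inE js orbT.
rewrite !big_cons; split; first exact: lowM.
have := rpredD (low_mul_eps li IH1 wm) IH2.
rewrite [X in X \in _ -> _](_ : _ = eps (F i * \prod_(j <- s) F j)%g w -
  (eps (F i) w + \sum_(j <- s) eps (F j) w)) //; ring.
Qed.

Variables (n : nat) (Filt : FG d -> Prop).
Hypotheses (n1 : (1 < n)%N) (Filt_subgrp : subgrp Filt)
  (lcs_Filt : forall x, lcs n x -> Filt x) (Filt_low : forall x, Filt x -> low n x).

(* Orders words by length, then by [wval]. *)
Definition rank v := (wval v + d.+2 ^ size v)%N.

Lemma rank_le u v : (rank v <= rank u)%N ->
  (size v < size u)%N \/ size v = size u /\ (wval v <= wval u)%N.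
Proof.
rewrite /rank => le; case: (ltngtP (size v) (size u)) => [|lt|E]; [by left| |right].
  have := wval_lt u; have : (d.+2 ^ (size u).+1 <= d.+2 ^ size v)%N by rewrite leq_pexp2l.
  by rewrite expnS; nia.
by rewrite E leq_add2r in le.
Qed.

(* A detecting word for [t]: the least word at which [t] can fail the
   congruences defining [low n], and failing there is the only obstruction to
   [Filt t]. *)
Definition detects v t := [/\ (0 < size v < n)%N, low (size v) t,
  forall w, size w = size v -> (wval w < wval v)%N -> (q (size w) %| eps t w)%Z &
  (q (size v) %| eps t v)%Z -> Filt t].

Hypothesis detect : forall c l t, lead c l -> (size l < n)%N -> gen (eq c) t ->
  Filt t \/ exists2 v, key v = key l & detects v t.

Lemma low_Filt x : low n x -> Filt x.
Proof.
have [F1 FM FV] := Filt_subgrp => lx.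
have [s [sP us] [h Hh E]] := magnus_normal_form x n1.
suff Fs r v : r \in s -> key v = key r.2.2 -> detects v r.1 -> Filt r.1.
  rewrite E; apply: FM; last exact: lcs_Filt.
  rewrite -(big_map (fun r : FG d * (FG d * word) => r.1) xpredT id).
  apply: subgrp_prod => // _ /mapP[r rs ->].
  have [Ct lc ln _] := sP _ rs; have [//|[v Ev Dv]] := detect lc ln Ct.
  exact: Fs Dv.
(* Strong induction on the rank of the detecting word [v] of [r]: all other factors satisfy the
   congruence at [v], so that of [x] passes to [r]. *)
have [m] := ubnP (rank v); elim: m r v => // m IH r v; rewrite ltnS => vm rs Ev Dv.
have [v0n lowr _ detr] := Dv.
have others r' : r' \in s -> r' != r ->
    low (size v) r'.1 /\ (q (size v) %| eps r'.1 v)%Z.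
  move=> r's ne; have [Ct lc ln _] := sP _ r's.
  have FF : Filt r'.1 -> low (size v) r'.1 /\ (q (size v) %| eps r'.1 v)%Z.
    by move/Filt_low => lr; split; [apply: low_le lr; case/andP: v0n => _ /ltnW | apply: lr].
  case: (detect lc ln Ct) => [/FF//|[v' Ev' Dv']].
  (* Smaller rank: [r'] is in [Filt] by induction. Larger rank: [v] precedes the first possible
     obstruction of [r']. Equal rank: the words, hence the keys, coincide, and [r'] would be [r]. *)
  have [lt|le] := ltnP (rank v') (rank v).
    by apply: FF; apply: (IH r' v') => //; apply: leq_trans vm.
  have [v0n' lowr' lowest _] := Dv'.
  have [lt|[svv' ]] := rank_le le.
    by split; [apply: low_le lowr'; apply: ltnW | apply: lowr'; case/andP: v0n => ->].
  rewrite leq_eqVlt => /predU1P[wvv'|lt]; last first.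
    by split; [rewrite svv' | apply: lowest].
  have vv' := wval_inj svv' wvv'.
  have Er : key r.2.2 = key r'.2.2 by rewrite -Ev -Ev' vv'.
  case/eqP: ne; exact/esym/(uniq_map_inj us).
have vle : (0 < size v <= size v)%N by rewrite leqnn andbT; case/andP: v0n.
have lows : {in s, forall r', low (size v) r'.1}.
  by move=> r' r's; have [->//|ne] := eqVneq r' r; have [] := others r' r's ne.
have [lp sumP] := low_prod_eps lows vle.
have lh := Filt_low (lcs_Filt Hh).
have lh' : low (size v) h by apply: low_le lh; case/andP: v0n => _ /ltnW.
have prodP := low_mul_eps lp lh' vle.
apply: detr.
move: sumP; rewrite (bigD1_seq r) //=; last exact: map_uniq us.
set rest := \sum_(_ <- _ | _) _ => sumP.
have restP : (q (size v) %| rest)%Z.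
  by rewrite /rest big_seq_cond; apply: rpred_sum => r' /andP[r's ne]; have [] := others r' r's ne.
have xv := lx v v0n; have hv := lh v v0n; rewrite -E in prodP.
set P := eps (\prod_(_ <- _) _)%g v in sumP prodP.
have -> : eps r.1 v =
    eps x v - (eps x v - (P + eps h v)) - eps h v - (P - (eps r.1 v + rest)) - rest.
  by ring.
by do ![apply: rpredB => //].
Qed.

End Congruences.

(** * Powers of lower central elements in the two p-filtrations *)

Section PowerSubgroups.
Variables (d p : nat).
Hypothesis pp : prime p.
Local Open Scope group_scope.
Implicit Types (x : FG d).

Lemma pcs_subgrp m : subgrp (@pcs d p m).
Proof. by case: m => [|[|m]] //; apply: gen_subgrp. Qed.

Lemma pcs_pow m x : (0 < m)%N -> pcs p m x -> pcs p m.+1 (x ^+ p).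
Proof.
case: m => // m _ Hx; apply: gen_in; left; apply: gen_in.
by exists x; rewrite fg_expE.
Qed.

Lemma lcs_pcs m x : lcs m x -> pcs p m x.
Proof.
elim: m x => [|[|m] IH] // x; rewrite lcsSE //.
apply: (gen_min (pcs_subgrp _)) => _ [y [f [Hy [_ ->]]]].
by apply: gen_in; right; apply: gen_in; exists y, f; split; first exact: IH.
Qed.

Lemma pcs_lcs_pow m e x : (0 < m)%N -> lcs m x -> pcs p (m + e) (x ^+ (p ^ e)).
Proof.
move=> m0 Hx; elim: e => [|e IH]; first by rewrite addn0 expn0 expg1; apply: lcs_pcs.
by rewrite addnS expnSr expgnA; apply: pcs_pow => //; rewrite addn_gt0 m0.
Qed.

Lemma zass_subgrp m : subgrp (@zass d p m).
Proof. by rewrite /zass; case: m => [|m] //=; case: ifP => // _; apply: gen_subgrp. Qed.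

Lemma lcs_zass_aux k m x : (m <= k)%N -> lcs m x -> zass_aux p k m x.
Proof.
elim: k m x => [|k IH] m x // mk /=; case: leqP => // m1.
case: m m1 mk => // m m1 mk; rewrite lcsSE //.
apply: (gen_min (gen_subgrp _)) => _ [y [f [Hy [_ ->]]]].
apply: gen_in; right; exists m, 1%N; split=> //; first by rewrite addn1.
apply: gen_in; exists y, f; split; first exact: IH.
by split=> //; case: (k).
Qed.

(** Taking a p-th power off replaces [m] by the ceiling of [m / p], which preserves the bound
    [m <= w * p ^ e] with [e] lowered by one. *)
Lemma zass_lcs_pow e k m w x : (m <= k)%N -> (m <= w * p ^ e)%N -> lcs w x ->
  zass_aux p k m (x ^+ (p ^ e)).
Proof.
move=> + + Hx; elim: e k m => [|e IH] k m mk mw.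
  rewrite expn0 expg1; apply: lcs_zass_aux => //; apply: lcs_le Hx.
  by rewrite expn0 muln1 in mw.
case: k mk => [|k] //= mk; case: leqP => // m1; apply: gen_in; left; apply: gen_in.
exists (x ^+ (p ^ e)); split; last by rewrite fg_expE -expgnA expnSr.
have p1 := prime_gt1 pp; have p0 := prime_gt0 pp.
apply: IH.
  rewrite -ltnS; apply: leq_trans mk; rewrite ltn_divLR //; nia.
rewrite -ltnS ltn_divLR //; move: mw; rewrite expnS; move: (p ^ e)%N => P; nia.
Qed.

End PowerSubgroups.

(** * Detecting words for powers of a leading element *)

Section Detection.
Variables (d n : nat) (q : nat -> nat) (Filt : FG d -> Prop).
Local Open Scope ring_scope.
Notation word := (seq 'I_d).
Implicit Types (u v w l : word) (c x y t : FG d).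
Hypothesis qM : forall a b, (0 < a)%N -> (0 < b)%N -> (q (a + b) %| q a * q b)%N.

Lemma low_pow_eps m c t k w : low q m c -> t = (c ^+ k)%g \/ t = (c ^- k)%g ->
  (0 < size w <= m)%N -> low q m t /\
  exists2 s : int, s = k%:R \/ s = - k%:R & (q (size w) %| eps t w - s * eps c w)%Z.
Proof.
move=> lc + wm; have [lk kP] := low_exp_eps qM k lc wm.
case=> ->; first by split=> //; exists k%:R => //; left.
split; first exact: lowV.
exists (- k%:R); first by right.
have := rpredB (low_mulV_eps qM lk (lowV qM lk) wm) kP.
rewrite [X in X \in _ -> _](_ : _ = eps (c ^- k)%g w - - k%:R * eps c w) //; ring.
Qed.

Lemma lead_low c l : lead c l -> low q (size l) c.
Proof. by case=> _ Hc _ _ w wl; rewrite (lcs_eps0 Hc wl) dvdz0. Qed.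

(** The coefficient of [c^k] or [c^-k] at [l] is [k] or [-k] modulo [q (size l)], so the congruence
    there gives divisibility of [k]. *)
Lemma lead_detects c l t k : lead c l -> (size l < n)%N ->
  t = (c ^+ k)%g \/ t = (c ^- k)%g -> ((q (size l) %| k)%N -> Filt t) ->
  detects q n Filt l t.
Proof.
move=> lc ln Ht HF; have [l0 _ c1 cl] := lc.
have sl : (0 < size l)%N by case: (l) l0.
have P w := low_pow_eps (w := w) (lead_low lc) Ht.
split; first by rewrite sl ln.
- by have [] := P l; rewrite ?sl ?leqnn.
- move=> w sw wl; have [|_ [s _]] := P w; first by rewrite sw sl leqnn.
  by rewrite cl // mulr0 subr0.
have [|_ [s sk]] := P l; first by rewrite sl leqnn.
rewrite c1 mulr1 => H1 H2; apply: HF.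
have : (q (size l) %| s)%Z by rewrite -[s](subKr (eps t l)); apply: rpredB.
by case: sk => ->; rewrite dvdzE ?abszN natz.
Qed.

End Detection.

(** * Leading words modulo p of p-power exponents *)

Section ModP.
Variables (d p : nat).
Hypothesis pp : prime p.
Local Open Scope ring_scope.
Notation word := (seq 'I_d).
Implicit Types (u v w l : word) (c x y t : FG d).

(** Coefficient at [w] of [(Y - 1)^j], with [Y] the Magnus expansion of [y]: every factor takes a
    nonempty piece of [w]. *)
Fixpoint eps_sub1_exp y j w : int :=
  if j is j'.+1
  then \sum_(k < size w) eps y (take k.+1 w) * eps_sub1_exp y j' (drop k.+1 w)
  else (w == [::])%:R.

Lemma eps_exp_binomial y k w :
  eps (y ^+ k)%g w = \sum_(j < k.+1) 'C(k, j)%:R * eps_sub1_exp y j w.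
Proof.
elim: k w => [|k IH] w; first by rewrite big_ord1 mul1r.
rewrite expgS epsM big_ord_recl take0 drop0 eps_nil mul1r.
under eq_bigr => i _ do rewrite IH mulr_sumr.
rewrite exchange_big IH [RHS]big_ord_recl /= bin0 mul1r.
have -> : \sum_(j < k.+1) 'C(k, j)%:R * eps_sub1_exp y j w =
    eps_sub1_exp y 0 w + \sum_(j < k.+1) 'C(k, j.+1)%:R * eps_sub1_exp y j.+1 w.
  rewrite big_ord_recl bin0 mul1r; congr (_ + _).
  by rewrite [RHS]big_ord_recr /= bin_small // mul0r addr0.
rewrite -addrA -big_split; congr (_ + _); apply: eq_bigr => j _ /=.
rewrite binS natrD mulrDl; congr (_ + _); rewrite mulr_sumr.
by apply: eq_bigr => i _; rewrite mulrCA.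
Qed.

(** Modulo [p], [Y^p - 1] equals [(Y - 1)^p]; the constant 1 is invisible at nonempty words. *)
Lemma eps_exp_prime y w : (0 < size w)%N ->
  (p %| eps (y ^+ p)%g w - eps_sub1_exp y p w)%Z.
Proof.
move=> w0; rewrite eps_exp_binomial.
case: p pp => // p' pp'; rewrite big_ord_recl big_ord_recr /=.
have -> : (w == [::])%:R = 0 :> int by case: (w) w0.
rewrite mulr0 add0r /bump /= add1n binn mul1r addrK; apply: rpred_sum => j _.
apply: dvdz_mulr; rewrite /bump /= add1n.
have : (p'.+1 %| 'C(p'.+1, j.+1))%N by apply: prime_dvd_bin; rewrite //= ltnS.
by rewrite natz dvdzE.
Qed.

Definition wpow v j := iter j (cat v) [::].

Lemma size_wpow v j : size (wpow v j) = (j * size v)%N.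
Proof. by elim: j => //= j IH; rewrite size_cat IH mulSn. Qed.

Lemma wpow_neq0 v j : v != [::] -> wpow v j.+1 != [::].
Proof. by case: v. Qed.

Lemma key_wpow v j : v != [::] -> key (wpow v j.+1) = key v.
Proof.
move=> v0; elim: j => [|j IH]; first by rewrite /= cats0.
by rewrite [wpow _ _]/= (key_cat_eq v0 (wpow_neq0 j v0)) // IH.
Qed.

(** Leading words modulo [p], with a coefficient prime to [p] instead of 1; this form survives p-th
    powers. *)
Definition plead y v := [/\ v != [::], low (fun=> p) (size v) y,
  forall w, size w = size v -> (wval w < wval v)%N -> (p %| eps y w)%Z
  & ~~ (p %| eps y v)%Z].

(** Pieces shorter than [v] have coefficient 0 modulo [p], so at length [j * size v] only the cut
    after [size v] letters counts, and the least word is [v] repeated [j] times. *)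
Lemma eps_sub1_exp_lead y v j w : plead y v -> (size w <= j * size v)%N ->
  ((size w < j * size v)%N || (wval w < wval (wpow v j))%N -> (p %| eps_sub1_exp y j w)%Z) /\
  (w = wpow v j -> (p %| eps_sub1_exp y j w - eps y v ^+ j)%Z).
Proof.
move=> [v0 ly lv _]; elim: j w => [|j IH] w; first by case: w => //=; rewrite subrr dvdz0.
have sv : (0 < size v)%N by case: (v) v0.
move=> wj; have Z (k : 'I_(size w)) : (k.+1 != size v) || (size w < j.+1 * size v)%N ->
    (p %| eps y (take k.+1 w) * eps_sub1_exp y j (drop k.+1 w))%Z.
  have kw := ltn_ord k.
  have st : size (take k.+1 w) = k.+1 by rewrite size_takel.
  have sd : size (drop k.+1 w) = (size w - k.+1)%N by rewrite size_drop.
  case: (ltnP k.+1 (size v)) => [lt _|ge ne].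
    by apply: dvdz_mulr; apply: ly; rewrite st.
  have sdj : (size (drop k.+1 w) < j * size v)%N by rewrite sd; move: wj ne; rewrite mulSn; lia.
  by apply: dvdz_mull; apply: (IH _ (ltnW sdj)).1; rewrite sdj.
have main : size w = (j.+1 * size v)%N ->
    (p %| eps_sub1_exp y j.+1 w - eps y (take (size v) w) * eps_sub1_exp y j (drop (size v) w))%Z.
  move=> sw; have kw : ((size v).-1 < size w)%N by rewrite sw mulSn; lia.
  rewrite /= (bigD1 (Ordinal kw)) //= prednK // addrAC subrr add0r.
  apply: rpred_sum => k ne; apply: Z; apply/orP; left.
  by apply: contraNneq ne => kv; apply/eqP/val_inj; rewrite /= -kv.
split.
  case: ltngtP wj => // [lt _ _|sw _ /= lt].
    by apply: rpred_sum => k _; apply: Z; rewrite lt orbT.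
  rewrite -[X in (_ %| X)%Z](subrK (eps y (take (size v) w) * eps_sub1_exp y j (drop (size v) w))).
  apply: rpredD; first exact: main.
  have sw' : size w = (size v + size (wpow v j))%N by rewrite size_wpow sw mulSn.
  have [lt'|[_ lt']] := wval_lt_cat sw' lt.
    by apply: dvdz_mulr; apply: lv => //; rewrite size_takel // sw' leq_addr.
  by apply: dvdz_mull; apply: (IH _ _).1; rewrite ?lt' ?orbT // size_drop sw mulSn addKn.
move=> wE; have sw : size w = (j.+1 * size v)%N by rewrite wE size_wpow.
have := main sw; rewrite {2 3}wE take_size_cat // drop_size_cat // => H1.
have H2 := (IH (wpow v j) _).2 erefl.
rewrite -[eps_sub1_exp y j.+1 w](subrK (eps y v * eps_sub1_exp y j (wpow v j))) -addrA.
apply: rpredD => //.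
by rewrite exprS -mulrBr; apply: dvdz_mull; apply: H2; rewrite size_wpow.
Qed.

Lemma prime_dvdzM (a b : int) : (p %| a * b)%Z = (p %| a)%Z || (p %| b)%Z.
Proof. by rewrite !dvdzE abszM Euclid_dvdM. Qed.

Lemma prime_dvdzX (a : int) j : (p %| a ^+ j)%Z -> (p %| a)%Z.
Proof.
elim: j => [|j IH]; first by rewrite expr0 dvdz1 absz_nat; case: p pp => [|[]].
by rewrite exprS prime_dvdzM => /orP[].
Qed.

Lemma plead_exp_prime y v : plead y v -> plead (y ^+ p)%g (wpow v p).
Proof.
move=> yv; have [v0 ly lv nv] := yv; have sv : (0 < size v)%N by case: (v) v0.
have p0 := prime_gt0 pp.
have R w : (0 < size w)%N -> (p %| eps_sub1_exp y p w)%Z -> (p %| eps (y ^+ p)%g w)%Z.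
  move=> w0 H; rewrite -[eps _ w](subrK (eps_sub1_exp y p w)); apply: rpredD => //.
  exact: eps_exp_prime.
split.
- by rewrite -(prednK p0) wpow_neq0.
- move=> w; rewrite size_wpow => /andP[w0 wlt]; apply: R => //.
  by apply: (eps_sub1_exp_lead yv (ltnW wlt)).1; rewrite wlt.
- move=> w; rewrite size_wpow => sw wl; apply: R; first by rewrite sw muln_gt0 p0.
  by apply: (eps_sub1_exp_lead yv _).1; rewrite ?sw // wl orbT.
apply: contra nv => H.
have spv : (0 < size (wpow v p))%N by rewrite size_wpow muln_gt0 p0.
have [_ /(_ erefl) H1] := eps_sub1_exp_lead (w := wpow v p) (j := p) yv (eq_leq (size_wpow v p)).
have H2 := eps_exp_prime y spv.
have : (p %| eps y v ^+ p)%Z.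
  have -> : eps y v ^+ p = eps (y ^+ p)%g (wpow v p) -
     (eps (y ^+ p)%g (wpow v p) - eps_sub1_exp y p (wpow v p)) -
     (eps_sub1_exp y p (wpow v p) - eps y v ^+ p) by ring.
  by do ![apply: rpredB => //].
exact: prime_dvdzX.
Qed.

(** The word [v'] is [v] repeated [p^e] times, with the same periodic extension. *)
Lemma plead_exp_pexp y v e : plead y v ->
  exists v', [/\ plead (y ^+ (p ^ e))%g v', key v' = key v & size v' = (size v * p ^ e)%N].
Proof.
move=> yv; elim: e => [|e [v' [yv' kv' sv']]].
  by exists v; rewrite expn0 expg1 muln1.
exists (wpow v' p); split.
- by rewrite expnSr expgnA; apply: plead_exp_prime.
- by rewrite -kv' -(prednK (prime_gt0 pp)) key_wpow //; case: yv'.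
- by rewrite size_wpow sv' expnSr mulnC mulnA.
Qed.

Lemma dvdn_pp (a b : nat) : (0 < a)%N -> (0 < b)%N -> (p %| p * p)%N.
Proof. by move=> _ _; apply: dvdn_mulr. Qed.

Lemma plead_pow y t v s : plead y v -> ~~ (p %| s)%N ->
  t = (y ^+ s)%g \/ t = (y ^- s)%g -> plead t v.
Proof.
move=> [v0 ly lv nv] ps Ht; have sv : (0 < size v)%N by case: (v) v0.
have P w := low_pow_eps dvdn_pp (w := w) ly Ht.
split=> //.
- by have [] := P v; rewrite ?sv ?leqnn.
- move=> w sw wl; have [|_ [r _ H]] := P w; first by rewrite sw sv leqnn.
  rewrite -[eps t w](subrK (r * eps y w)); apply: rpredD => //.
  by apply: dvdz_mull; apply: lv.
have [|_ [r rs H]] := P v; first by rewrite sv leqnn.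
apply/negP => H'.
have : (p %| r * eps y v)%Z by rewrite -[_ * _](subKr (eps t v)); apply: rpredB.
rewrite prime_dvdzM (negPf nv) orbF => pr; case/negP: ps.
by case: rs pr => ->; rewrite dvdzE ?abszN natz.
Qed.

End ModP.

(** * Magnus congruences imply membership in the three filtrations *)

Section Main.
Variables (p d n : nat).
Hypotheses (pp : prime p) (n1 : (1 < n)%N).
Local Open Scope ring_scope.
Implicit Types (x t : FG d).

Lemma low_lcs x : low (fun=> 0%N) n x -> lcs n x.
Proof.
have q0 (a b : nat) : (0 < a)%N -> (0 < b)%N -> (0 %| 0 * 0)%N by [].
apply: (low_Filt q0 n1 (lcs_subgrp d n)) => // [y Hy w wn|c l t lc ln /gen_cycleP[k Hk]].
  by rewrite (lcs_eps0 Hy wn).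
right; exists l => //; apply: (lead_detects q0 lc ln Hk).
rewrite dvd0n => /eqP k0; have [F1 _ _] := lcs_subgrp d n.
by move: Hk; rewrite k0 => -[] ->; rewrite ?invg1.
Qed.

Lemma low_pcs x : low (fun k => p ^ (n - k))%N n x -> pcs p n x.
Proof.
have qM (a b : nat) : (0 < a)%N -> (0 < b)%N -> (p ^ (n - (a + b)) %| p ^ (n - a) * p ^ (n - b))%N.
  by move=> _ _; rewrite -expnD dvdn_exp2l //; lia.
have Fs := @pcs_subgrp d p n; have [_ _ FV] := Fs.
apply: (low_Filt qM n1 Fs) => [y|y Hy w wn|c l t lc ln /gen_cycleP[k Hk]].
- exact: lcs_pcs.
- exact: pcs_dvd_eps.
right; exists l => //; apply: (lead_detects qM lc ln Hk) => /dvdnP[s ks].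
have [l0 Hc _ _] := lc; have sl : (0 < size l)%N by case: (l) l0.
have : pcs p n (c ^+ k)%g.
  rewrite ks mulnC expgnA; apply: subgrpX => //.
  by rewrite -{1}(subnKC (ltnW ln)); apply: pcs_lcs_pow.
by case: Hk => -> // /FV.
Qed.

Lemma low_zass x : low (fun=> p) n x -> zass p n x.
Proof.
have Fs := @zass_subgrp d p n; have [F1 _ FV] := Fs.
apply: (low_Filt (@dvdn_pp p) n1 Fs) => [y|y Hy w wn|c l t lc ln /gen_cycleP[k Hk]].
- exact: lcs_zass_aux.
- exact: zass_dvd_eps Hy wn.
have [l0 Hc c1 cl] := lc; have sl : (0 < size l)%N by case: (l) l0.
case: (posnP k) => [k0|k0].
  by left; move: Hk; rewrite k0 => -[] ->; rewrite ?invg1.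
have [s ps ks] := pfactor_coprime pp k0.
rewrite ks mulnC !expgnA in Hk.
(* With [k = s p^e] and [s] prime to [p]: if [size l * p^e >= n], the power is already in
   [zass p n]. Otherwise [l] repeated [p^e] times has a coefficient prime to [p], so the final
   implication of [detects] is vacuous. *)
have [le|lt] := leqP n (size l * p ^ logn p k).
  left; have : zass p n ((c ^+ (p ^ logn p k)) ^+ s)%g.
    by apply: subgrpX => //; apply: zass_lcs_pow Hc.
  by case: Hk => -> // /FV.
have cP : plead p c l.
  split=> //; first exact: lead_low.
    by move=> w sw wl; rewrite cl // dvdz0.
  by rewrite c1 dvdz1 /= neq_ltn prime_gt1 // orbT.
have [v [yv kv sv]] := plead_exp_pexp pp (logn p k) cP.
have nps : ~~ (p %| s)%N by rewrite -prime_coprime.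
have [v0 tl tw tn] := plead_pow pp yv nps Hk.
right; exists v => //; split=> //; last by move=> H; rewrite H in tn.
by rewrite sv lt muln_gt0 sl expn_gt0 prime_gt0.
Qed.

End Main.

Theorem theorem2p7 (p d n : nat) (hp : prime p) (hn : (1 <= n)%N) :
  (* (a) *)
  (forall x : FG d, zass p n x <->
     (forall rho : FG d -> 'M['F_p]_n, hom_to_U rho -> rho x = 1%:M%R)) /\
  (* (b) *)
  (forall x : FG d, lcs n x <->
     (forall rho : FG d -> 'M[int]_n, hom_to_U rho -> rho x = 1%:M%R)) /\
  (* (c) *)
  (forall x : FG d, pcs p n x <->
     (forall k : nat, (1 <= k <= n.-1)%N ->
        forall rho : FG d -> 'M['Z_(p ^ (n - k))]_k.+1, hom_to_U rho -> rho x = 1%:M%R)).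
Proof.
have pexp_gt1 m : (0 < m)%N -> (1 < p ^ m)%N.
  by case: m => // m _; rewrite expnS (leq_trans (prime_gt1 hp)) // leq_pmulr // expn_gt0 prime_gt0.
split; [|split] => x; split=> [Hx|kill].
- by move=> rho Hrho; apply: (hom_to_U_zass Hrho hp) Hx; apply: pchar_Fp_0.
(* For [n = 1] the term is the whole group. For [n = m + 2], matrices of size [m + 2] see all words
   of length at most [m + 1], the range of [low n]. *)
- case: n hn kill => [|[|m]] // _ kill; apply: low_zass => // u su.
  by rewrite (dvdz_pcharf (pchar_Fp hp)); apply/eqP/(eps_eq0 su).
- by move=> rho Hrho; apply: hom_to_U_lcs Hx.
- case: n hn kill => [|[|m]] // _ kill; apply: low_lcs => // u su.
  by rewrite -(intz (eps x u)) (eps_eq0 su kill) dvdz0.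
- move=> k /andP[k0 kn] rho Hrho; apply: (hom_to_U_pcs Hrho hp _ Hx).
  by apply/pchar_Zp/pexp_gt1; lia.
case: n hn kill => [|[|m]] // _ kill; apply: low_pcs => // u su.
rewrite -intr_Zp_eq0; last by apply: pexp_gt1; lia.
(* Choose [k] as the length of [u], so that the modulus [p^(n - k)] is the one [low] asks for at
   [u]. *)
apply/eqP; apply: (eps_eq0 (n := size u)); first by lia.
by apply: kill; lia.
Qed.
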